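(* For $\lambda\mu$-terms $M,N$: if $M=_{\beta\mu}N$, then $[\![M]\!]_a\approx[\![N]\!]_a$.
   Context: $\lambda\mu$-terms: $M ::= x\mid\lambda x.M\mid MN\mid\mu\alpha.[\beta]M$. $M[N/x]$ substitution, $M[\beta/\gamma]$ renaming, $M[N\cdot\gamma/\alpha]$ replaces recursively each subterm $[\alpha]M'$ by $[\gamma](M'[N\cdot\gamma/\alpha])N$. $\to_{\beta\mu}$: closure under all contexts of $(\lambda x.M)N\to M[N/x]$; $(\mu\alpha.[\beta]M)N\to\mu\gamma.(([\beta]M)[N\cdot\gamma/\alpha])$ ($\gamma$ fresh); $\mu\delta.[\beta]\mu\gamma.[\alpha]M\to\mu\delta.(([\alpha]M)[\beta/\gamma])$; $\mu\alpha.[\alpha]M\to M$ ($\alpha\notin\mathrm{fn}(M)$). $=_{\beta\mu}$ is the generated congruence. $\pi$-calculus with pairing: data $p::=a\mid\langle a,b\rangle$; processes $P ::= 0\mid P|Q\mid!P\mid(\nu a)P\mid a(x).P\mid\overline a\langle p\rangle.P\mid\mathrm{let}\ \langle x,y\rangle=p\ \mathrm{in}\ P$; $a(y,z).P$ abbreviates $a(x).\mathrm{let}\ \langle y,z\rangle=x\ \mathrm{in}\ P$; forwarder $a\to b$ is $a(x).\overline b\langle x\rangle$. Structural congruence: least congruence with $P|0\equiv P$, commutativity/associativity of $|$, $!P\equiv P|!P$, $(\nu n)0\equiv0$, $(\nu m)(\nu n)P\equiv(\nu n)(\nu m)P$, $(\nu n)(P|Q)\equiv P|(\nu n)Q$ ($n\notin\mathrm{fn}(P)$),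 $\mathrm{let}\ \langle x,y\rangle=\langle a,b\rangle\ \mathrm{in}\ P\equiv P[a/x,b/y]$. Reduction: $\overline a\langle p\rangle.P\mid a(x).Q\to P\mid Q[p/x]$, closed under restriction, $|$ and $\equiv$. Output (input) barb on $n$: $P\equiv(\nu\vec b)(\overline n\langle p\rangle.Q\mid R)$ (resp. $n(x).Q$), $n\notin\vec b$; weak barb: after some reductions. Barbed bisimilarity $\sim$: largest symmetric relation where barbs of $P$ are weak barbs of $Q$ and $P\to^*P'$ is matched by $Q\to^*Q'$ with $P'\sim Q'$. $P\approx Q$ iff $C[P]\sim C[Q]$ for all contexts $C$. Interpretation ($u,b,c,v,d$ fresh): $[\![x]\!]_a=x(u).!(u\to a)$; $[\![\lambda x.M]\!]_a=(\nu xb)([\![M]\!]_b\mid\overline a\langle x,b\rangle)$; $[\![MN]\!]_a=(\nu c)([\![M]\!]_c\mid!c(v,d).([\![v:=N]\!]\mid!(d\to a)))$ where $[\![v:=N]\!]=!(\nu w)(\overline v\langle w\rangle.[\![N]\!]_w)$; $[\![\mu\gamma.[\beta]M]\!]_a=[\![M]\!]_\beta[a/\gamma]$. *)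

(* Defs.v *)
(** Lambda-mu terms and pi-calculus processes are taken up to alpha-conversion;
    both are represented with de Bruijn indices, so that an index [n] occurring
    under [k] binders with [k <= n] stands for the free identifier [n - k]. *)
From Stdlib Require Import Arith Relations.

Set Implicit Arguments.

Definition scons (X : Type) (x : X) (f : nat -> X) (n : nat) : X :=
  match n with 0 => x | S m => f m end.

Definition idr (n : nat) : nat := n.

(** A renaming pushed under one binder. *)
Definition up (r : nat -> nat) : nat -> nat := scons 0 (fun n => S (r n)).

(** * The lambda-mu calculus *)

(** Variables and names are two separate families of indices: [Lam] binds a
    variable, and [Mu b M], which is [mu alpha.[b]M], binds the name [alpha]
    (index 0) both in [b] and in [M]. *)
Inductive term : Type :=
| Var (x : nat)
| Lam (M : term)
| App (M N : term)
| Mu (b : nat) (M : term).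

(** [rv] renames variables, [rn] renames names. *)
Fixpoint tren (rv rn : nat -> nat) (M : term) : term :=
  match M with
  | Var x => Var (rv x)
  | Lam M => Lam (tren (up rv) rn M)
  | App M N => App (tren rv rn M) (tren rv rn N)
  | Mu b M => Mu (up rn b) (tren rv (up rn) M)
  end.

Definition vshift : term -> term := tren S idr.
Definition nshift : term -> term := tren idr S.

Fixpoint tsub (s : nat -> term) (M : term) : term :=
  match M with
  | Var x => s x
  | Lam M => Lam (tsub (scons (Var 0) (fun x => vshift (s x))) M)
  | App M N => App (tsub s M) (tsub s N)
  | Mu b M => Mu b (tsub (fun x => nshift (s x)) M)
  end.

(** [M[N/x]], where [x] is the variable 0 of [M]. *)
Definition subst_var (M N : term) : term := tsub (scons N Var) M.

(** The body [[b]M] of a [mu], where [M'] is [M[N.g/a]] already, is turned into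
    [[g]M'N] when [b = a] and into [[b]M'] otherwise. *)
Definition mu_cmd (N : term) (g a b : nat) (M' : term) : term :=
  if b =? a then Mu g (App M' N) else Mu b M'.

(** [M[N.g/a]] *)
Fixpoint ssub (N : term) (g a : nat) (M : term) : term :=
  match M with
  | Var x => Var x
  | Lam M => Lam (ssub (vshift N) g a M)
  | App M1 M2 => App (ssub N g a M1) (ssub N g a M2)
  | Mu b M =>
      mu_cmd (nshift N) (S g) (S a) b (ssub (nshift N) (S g) (S a) M)
  end.

(** In [red_mu] the contractum is [mu gamma.([b]M)[N.gamma/alpha]]: as all the
    occurrences of [alpha] disappear and [nshift N] does not contain the bound
    name, the fresh [gamma] may take over the index 0 of [alpha].  In
    [red_erase], the subject of the rule is [mu alpha.[alpha]M] with [alpha]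
    not free in [M]. *)
Inductive red : term -> term -> Prop :=
| red_beta M N : red (App (Lam M) N) (subst_var M N)
| red_mu b M N :
    red (App (Mu b M) N)
        (mu_cmd (nshift N) 0 0 b (ssub (nshift N) 0 0 M))
| red_rename b a M :
    red (Mu b (Mu a M)) (Mu (scons b idr a) (tren idr (scons b idr) M))
| red_erase M : red (Mu 0 (nshift M)) M
| red_lam M M' : red M M' -> red (Lam M) (Lam M')
| red_appl M M' N : red M M' -> red (App M N) (App M' N)
| red_appr M N N' : red N N' -> red (App M N) (App M N')
| red_mu_body b M M' : red M M' -> red (Mu b M) (Mu b M').

Definition eq_bm : term -> term -> Prop := clos_refl_sym_trans term red.

(** * The pi-calculus with pairing *)

(** The grammar of data and processes is relaxed so that [Q[p/x]] is defined for
    every datum [p]: data may stand wherever a name may.  Replacing [x] by a pair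
    in [x(y).P], or inside another pair, thus gives a term outside the grammar;
    it is kept as it is.  Such terms only arise during reduction: [is_proc] and
    [is_ctx] below single out the grammar
    [p ::= a | <a,b>], [P ::= ... | a(x).P | a<p>.P | let <x,y> = p in P], and a
    prefix whose subject is a pair neither communicates nor is a barb. *)
Inductive data : Type :=
| Name (a : nat)
| Pair (p q : data).

(** [In (Name a) P] is [a(x).P] with [x] the index 0 of [P]; [Let p P] is
    [let <x,y> = p in P] with [x] the index 1 and [y] the index 0 of [P]. *)
Inductive proc : Type :=
| Nil
| Par (P Q : proc)
| Bang (P : proc)
| Nu (P : proc)
| In (s : data) (P : proc)
| Out (s p : data) (P : proc)
| Let (p : data) (P : proc).

Definition is_data (p : data) : Prop :=
  match p with
  | Name _ | Pair (Name _) (Name _) => True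
  | _ => False
  end.

Fixpoint is_proc (P : proc) : Prop :=
  match P with
  | Nil => True
  | Par P Q => is_proc P /\ is_proc Q
  | Bang P | Nu P | In (Name _) P => is_proc P
  | Out (Name _) p P => is_data p /\ is_proc P
  | Let p P => is_data p /\ is_proc P
  | In (Pair _ _) _ | Out (Pair _ _) _ _ => False
  end.

(** Simultaneous substitution of data for free names. *)
Fixpoint dsub (f : nat -> data) (p : data) : data :=
  match p with
  | Name a => f a
  | Pair p q => Pair (dsub f p) (dsub f q)
  end.

Definition dup (f : nat -> data) : nat -> data :=
  scons (Name 0) (fun n => dsub (fun m => Name (S m)) (f n)).

Fixpoint psub (f : nat -> data) (P : proc) : proc :=
  match P with
  | Nil => Nil
  | Par P Q => Par (psub f P) (psub f Q)
  | Bang P => Bang (psub f P)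
  | Nu P => Nu (psub (dup f) P)
  | In s P => In (dsub f s) (psub (dup f) P)
  | Out s p P => Out (dsub f s) (dsub f p) (psub f P)
  | Let p P => Let (dsub f p) (psub (dup (dup f)) P)
  end.

Definition ren (r : nat -> nat) : proc -> proc := psub (fun n => Name (r n)).

Definition swap01 : nat -> nat := scons 1 (scons 0 (fun n => S (S n))).

(** The side condition of [sc_scope], that the restricted name is not free in
    the left component, is expressed by that component being [ren S P]. *)
Inductive scong : proc -> proc -> Prop :=
| sc_par_nil P : scong (Par P Nil) P
| sc_par_comm P Q : scong (Par P Q) (Par Q P)
| sc_par_assoc P Q R : scong (Par (Par P Q) R) (Par P (Par Q R))
| sc_bang P : scong (Bang P) (Par P (Bang P))
| sc_nu_nil : scong (Nu Nil) Nil
| sc_nu_swap P : scong (Nu (Nu P)) (Nu (Nu (ren swap01 P)))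
| sc_scope P Q : scong (Nu (Par (ren S P) Q)) (Par P (Nu Q))
| sc_let p q P :
    scong (Let (Pair p q) P) (psub (scons q (scons p Name)) P)
| sc_refl P : scong P P
| sc_sym P Q : scong P Q -> scong Q P
| sc_trans P Q R : scong P Q -> scong Q R -> scong P R
| sc_par P P' Q Q' : scong P P' -> scong Q Q' -> scong (Par P Q) (Par P' Q')
| sc_bang_body P P' : scong P P' -> scong (Bang P) (Bang P')
| sc_nu P P' : scong P P' -> scong (Nu P) (Nu P')
| sc_in s P P' : scong P P' -> scong (In s P) (In s P')
| sc_out s p P P' : scong P P' -> scong (Out s p P) (Out s p P')
| sc_let_body p P P' : scong P P' -> scong (Let p P) (Let p P').

Inductive step : proc -> proc -> Prop :=
| st_comm a p P Q :
    step (Par (Out (Name a) p P) (In (Name a) Q))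
         (Par P (psub (scons p Name) Q))
| st_nu P P' : step P P' -> step (Nu P) (Nu P')
| st_par P P' Q : step P P' -> step (Par P Q) (Par P' Q)
| st_scong P P' Q Q' :
    scong P P' -> step P' Q' -> scong Q' Q -> step P Q.

Definition steps : proc -> proc -> Prop := clos_refl_trans proc step.

Fixpoint nus (k : nat) (P : proc) : proc :=
  match k with 0 => P | S k => Nu (nus k P) end.

(** Under the [k] restrictions of [nus k], the free name [n] is [k + n]. *)
Definition out_barb (P : proc) (n : nat) : Prop :=
  exists k p Q R, scong P (nus k (Par (Out (Name (k + n)) p Q) R)).

Definition in_barb (P : proc) (n : nat) : Prop :=
  exists k Q R, scong P (nus k (Par (In (Name (k + n)) Q) R)).

Definition weak (barb : proc -> nat -> Prop) (P : proc) (n : nat) : Prop :=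
  exists P', steps P P' /\ barb P' n.

Definition barbed_bisimulation (R : proc -> proc -> Prop) : Prop :=
  (forall P Q, R P Q -> R Q P) /\
  (forall P Q, R P Q ->
     (forall n, out_barb P n -> weak out_barb Q n) /\
     (forall n, in_barb P n -> weak in_barb Q n) /\
     (forall P', steps P P' -> exists Q', steps Q Q' /\ R P' Q')).

Definition barbed_bisimilar (P Q : proc) : Prop :=
  exists R, barbed_bisimulation R /\ R P Q.

(** Contexts capture free names of the process put in the hole, so their binders
    carry the name that they bind: [bind n] turns the free name [n] into the
    variable bound by a new enclosing binder, and [Nu (ren (bind n) P)] is thus
    [(nu n)P]. *)
Definition bind (n m : nat) : nat := if m =? n then 0 else S m.

Definition bind2 (x y m : nat) : nat :=
  if m =? y then 0 else if m =? x then 1 else S (S m).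

Inductive ctx : Type :=
| CHole
| CParL (C : ctx) (Q : proc)
| CParR (P : proc) (C : ctx)
| CBang (C : ctx)
| CNu (n : nat) (C : ctx)
| CIn (a x : nat) (C : ctx)
| COut (a : nat) (p : data) (C : ctx)
| CLet (x y : nat) (p : data) (C : ctx).

Fixpoint plug (C : ctx) (P : proc) : proc :=
  match C with
  | CHole => P
  | CParL C Q => Par (plug C P) Q
  | CParR Q C => Par Q (plug C P)
  | CBang C => Bang (plug C P)
  | CNu n C => Nu (ren (bind n) (plug C P))
  | CIn a x C => In (Name a) (ren (bind x) (plug C P))
  | COut a p C => Out (Name a) p (plug C P)
  | CLet x y p C => Let p (ren (bind2 x y) (plug C P))
  end.

Fixpoint is_ctx (C : ctx) : Prop :=
  match C with
  | CHole => True
  | CParL C Q => is_ctx C /\ is_proc Q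
  | CParR P C => is_proc P /\ is_ctx C
  | CBang C | CNu _ C | CIn _ _ C => is_ctx C
  | COut _ p C => is_data p /\ is_ctx C
  | CLet _ _ p C => is_data p /\ is_ctx C
  end.

Definition ctx_equiv (P Q : proc) : Prop :=
  forall C : ctx, is_ctx C -> barbed_bisimilar (plug C P) (plug C Q).

(** * The interpretation *)

(** [a(y,z).P], with [y] the index 1 and [z] the index 0 of [P]; the renaming
    makes room for the intermediate [x] in [a(x).let <y,z> = x in P]. *)
Definition in_pair (a : nat) (P : proc) : proc :=
  In (Name a) (Let (Name 0) (ren (up (up S)) P)).

(** The forwarder [a -> b]. *)
Definition fwd (a b : nat) : proc :=
  In (Name a) (Out (Name (S b)) (Name 0) Nil).

(** [!(nu w)(v<w>.P)], with [w] the index 0 of [P]. *)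
Definition server (v : nat) (P : proc) : proc :=
  Bang (Nu (Out (Name (S v)) (Name 0) P)).

(** [vs] and [ns] give the channels that stand for the variables and for the
    names of the term.  In the clause for [App], the [c], [v], [d] of
    [(nu c)([[M]]_c | !c(v,d).([[v:=N]] | !(d -> a)))] are 0 in [[M]]_c] and
    2, 1, 0 under the input prefix; for [Mu], the bound name is first interpreted
    as a new channel 0, which is then replaced by [a]. *)
Fixpoint interp (vs ns : nat -> nat) (a : nat) (M : term) : proc :=
  match M with
  | Var x => In (Name (vs x)) (Bang (fwd 0 (S a)))
  | Lam M =>
      Nu (Nu (Par
        (interp (scons 1 (fun x => 2 + vs x)) (fun g => 2 + ns g) 0 M)
        (Out (Name (2 + a)) (Pair (Name 1) (Name 0)) Nil)))
  | App M N =>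
      Nu (Par
        (interp (fun x => 1 + vs x) (fun g => 1 + ns g) 0 M)
        (Bang (in_pair 0 (Par
          (server 1 (interp (fun x => 4 + vs x) (fun g => 4 + ns g) 0 N))
          (Bang (fwd 0 (3 + a)))))))
  | Mu b M =>
      let ns' := scons 0 (fun g => 1 + ns g) in
      ren (scons a idr) (interp (fun x => 1 + vs x) ns' (ns' b) M)
  end.

(** The free variables and the free names of a term are distinct channels. *)
Definition var_chan (x : nat) : nat := 2 * x.
Definition name_chan (g : nat) : nat := 2 * g + 1.

Definition sem (a : nat) (M : term) : proc := interp var_chan name_chan a M.

(* Main.v *)
(** A private channel [c] that occurs only as the subject of outputs without
    continuation, next to a single server [!c(z).R], can be eliminated: replace
    each [c<p>] by [R[p/z]].  Dually, if [c] occurs only as the subject of inputs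
    [c(u).Q] next to [!(nu w)c<w>.T], replace each of them by [(nu w)(T | Q[w/u])].
    Each such communication is the only possible future of the prefix, so that
    performing it in advance is invisible.

    Interpret the names of a term by such resources [R] instead of channels.
    Both sides of the structural rule then have the same interpretation, the one
    where [alpha] stands for "apply to [N] and continue on [gamma]"; in the beta
    rule, eliminating the servers of the application, of the forwarder and of
    the explicit substitution turns the redex into its contractum.

    The eliminations and the axioms of structural congruence are closed together
    under all contexts, and shown to be a bisimulation on an abstract machine
    whose states are multisets of threads under restrictions: as a state is the
    whole system, no labelled transitions or scope extrusion are needed. *)
From Stdlib Require Import List Permutation Lia Arith Relations.
Import ListNotations.
Require Import Defs.

(** In the eliminating relation the right process is always ahead. It follows the left one at once,
    but to answer a move of the right the left must first perform its postponed communications. This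
    terminates because resource bodies, and the data and continuations that meet them, mention no
    private channel: a communication made up for leaves the same process on both sides and postpones
    nothing new. The delicate case is a server [!(nu w)c<w>.T]. On the left, unfolding a copy
    creates [w] before any partner is known; on the right, [w] appears only where a prefix was
    replaced. Such early names are private too ([KRes]), and are realigned when the communication
    happens. Having structural congruence among the axioms puts it inside the bisimulation by
    construction. Reductions and barbs, which are defined up to congruence, are thus transferred to
    a machine without congruence rule, and no derivation of [scong] is ever inverted. *)

(** * Algebra of simultaneous substitutions *)

Lemma dsub_ext f g p : (forall n, f n = g n) -> dsub f p = dsub g p.
Proof. intros H; induction p; simpl; congruence. Qed.

Lemma dsub_comp f g p : dsub g (dsub f p) = dsub (fun n => dsub g (f n)) p.
Proof. induction p; simpl; congruence. Qed.

Lemma dsub_id p : dsub Name p = p.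
Proof. induction p; simpl; congruence. Qed.

Lemma dup_ext f g : (forall n, f n = g n) -> forall n, dup f n = dup g n.
Proof. intros H [|n]; simpl; congruence. Qed.

Lemma dup_comp f g n : dsub (dup g) (dup f n) = dup (fun m => dsub g (f m)) n.
Proof. destruct n; simpl; auto. now rewrite !dsub_comp. Qed.

Lemma dup_id n : dup Name n = Name n.
Proof. now destruct n. Qed.

Lemma psub_ext P : forall f g, (forall n, f n = g n) -> psub f P = psub g P.
Proof.
  induction P; intros f g H; simpl; f_equal; auto using dsub_ext, dup_ext.
Qed.

Lemma psub_comp P : forall f g,
  psub g (psub f P) = psub (fun n => dsub g (f n)) P.
Proof.
  induction P; intros f g; simpl; rewrite ?dsub_comp, ?IHP, ?IHP1, ?IHP2;
    f_equal; auto; apply psub_ext; intros n; rewrite ?dup_comp; auto.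
  apply dup_ext; intros m; apply dup_comp.
Qed.

Lemma psub_id P : forall f, (forall n, f n = Name n) -> psub f P = P.
Proof.
  assert (D : forall f, (forall n, f n = Name n) -> forall n, dup f n = Name n).
  { intros f H n. rewrite <- dup_id. now apply dup_ext. }
  assert (E : forall f p, (forall n, f n = Name n) -> dsub f p = p).
  { intros f p H. rewrite <- (dsub_id p) at 2. now apply dsub_ext. }
  induction P; intros f H; simpl; f_equal; auto.
Qed.

Lemma ren_comp r s P : ren s (ren r P) = ren (fun n => s (r n)) P.
Proof. unfold ren. now rewrite psub_comp. Qed.

Lemma ren_ext r s P : (forall n, r n = s n) -> ren r P = ren s P.
Proof. intros H; apply psub_ext; intros; now rewrite H. Qed.

Lemma ren_id r P : (forall n, r n = n) -> ren r P = P.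
Proof. intros H; apply psub_id; intros; now rewrite H. Qed.

Lemma dup_ren r n : dup (fun m => Name (r m)) n = Name (up r n).
Proof. now destruct n. Qed.

Lemma up_ext r s : (forall n, r n = s n) -> forall n, up r n = up s n.
Proof. intros H [|n]; simpl; congruence. Qed.

(* Equations between iterated substitutions, checked on the first indices. *)
Ltac psub_solve :=
  unfold ren; rewrite ?psub_comp;
  first [apply psub_ext | apply psub_id];
  let n := fresh "n" in
  intros n; do 6 (try destruct n as [|n]; simpl); unfold idr;
  rewrite ?dsub_comp; simpl; rewrite ?dsub_comp; simpl; 
  rewrite ?dsub_id; try reflexivity.

Definition upn (d : nat) (r : nat -> nat) : nat -> nat := Nat.iter d up r.

Lemma ren_Par r P Q : ren r (Par P Q) = Par (ren r P) (ren r Q).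
Proof. reflexivity. Qed.
Lemma ren_Bang r P : ren r (Bang P) = Bang (ren r P).
Proof. reflexivity. Qed.
Lemma ren_Nu r P : ren r (Nu P) = Nu (ren (up r) P).
Proof. unfold ren; simpl; f_equal; apply psub_ext, dup_ren. Qed.
Lemma ren_In r s P :
  ren r (In s P) = In (dsub (fun n => Name (r n)) s) (ren (up r) P).
Proof. unfold ren; simpl; f_equal; apply psub_ext, dup_ren. Qed.
Lemma ren_Out r s p P : ren r (Out s p P)
  = Out (dsub (fun n => Name (r n)) s) (dsub (fun n => Name (r n)) p) (ren r P).
Proof. reflexivity. Qed.
Lemma ren_Let r p P : ren r (Let p P)
  = Let (dsub (fun n => Name (r n)) p) (ren (up (up r)) P).
Proof.
  unfold ren; simpl; f_equal; apply psub_ext; intros n.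
  rewrite <- dup_ren. apply dup_ext, dup_ren.
Qed.

(** * Names occurring in a process *)

Fixpoint pd (A : nat -> Prop) (p : data) : Prop :=
  match p with Name a => A a | Pair p q => pd A p /\ pd A q end.

Fixpoint pl (A : nat -> Prop) (P : proc) : Prop :=
  match P with
  | Nil => True
  | Par P Q => pl A P /\ pl A Q
  | Bang P => pl A P
  | Nu P => pl (scons True A) P
  | In s P => pd A s /\ pl (scons True A) P
  | Out s p P => pd A s /\ pd A p /\ pl A P
  | Let p P => pd A p /\ pl (scons True (scons True A)) P
  end.

Lemma pd_ext_sub A f g p :
  pd A p -> (forall n, A n -> f n = g n) -> dsub f p = dsub g p.
Proof. intros H E; induction p; simpl in *; f_equal; intuition. Qed.

Lemma pd_sub (A B : nat -> Prop) f p :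
  pd A p -> (forall n, A n -> pd B (f n)) -> pd B (dsub f p).
Proof. intros H E; induction p; simpl in *; intuition. Qed.

Lemma pl_ext_sub P : forall A f g,
  pl A P -> (forall n, A n -> f n = g n) -> psub f P = psub g P.
Proof.
  assert (D : forall (A : nat -> Prop) f g, (forall n, A n -> f n = g n) ->
    forall n, scons True A n -> dup f n = dup g n).
  { intros A f g H [|n] Hn; simpl in *; auto. now rewrite H. }
  induction P; intros A f g H E; simpl in *; f_equal; intuition eauto using pd_ext_sub.
Qed.

Lemma pl_sub P : forall (A B : nat -> Prop) f,
  pl A P -> (forall n, A n -> pd B (f n)) -> pl B (psub f P).
Proof.
  assert (D : forall (A B : nat -> Prop) f, (forall n, A n -> pd B (f n)) ->
    forall n, scons True A n -> pd (scons True B) (dup f n)).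
  { intros A B f H [|n] Hn; simpl in *; auto.
    apply (@pd_sub B); auto. }
  induction P; intros A B f H E; simpl in *; intuition eauto 6 using pd_sub.
Qed.

Lemma pd_all (A : nat -> Prop) p : (forall n, A n) -> pd A p.
Proof. intros H; induction p; simpl; auto. Qed.

Lemma pl_all P : forall A : nat -> Prop, (forall n, A n) -> pl A P.
Proof.
  assert (D : forall A : nat -> Prop, (forall n, A n) -> forall n, scons True A n).
  { intros A H [|n]; simpl; auto. }
  induction P; intros A H; simpl; auto 6 using pd_all.
Qed.

Lemma pl_mono P (A B : nat -> Prop) : pl A P -> (forall n, A n -> B n) -> pl B P.
Proof.
  intros H E. rewrite <- (@psub_id P Name) by auto. now apply (@pl_sub P A).
Qed.
(** * A compatible relation that eliminates private resources *)

(* What a private channel [c] is used for: [KIn R] if its server is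
   [!c(z).R], [KOut T] if it is [!(nu w)c<w>.T]; [KRes] marks a name [w] that
   an unfolded copy of a server of the second sort has already created. *)
Inductive kind : Type :=
| KIn (R : proc)
| KOut (T : proc)
| KRes.

Definition env := nat -> option kind.

Definition kmap (f : nat -> data) (K : kind) : kind :=
  match K with
  | KIn R => KIn (psub (dup f) R)
  | KOut T => KOut (psub (dup f) T)
  | KRes => KRes
  end.

(** [o] is the use of the newly bound name; the resource bodies recorded in [G] have free names of
    their own, hence the shift. *)
Definition gup (o : option kind) (G : env) : env := fun n =>
  match n with
  | 0 => o
  | S m => match G m with None => None | Some K => Some (kmap (fun i => Name (S i)) K) end
  end.

Definition nn (G : env) (n : nat) : Prop := G n = None.

(** Index 0 is the parameter of a resource. Banning private channels elsewhere makes an eliminated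
    communication end in a process that both sides share. *)
Definition bpl (G : env) (P : proc) : Prop := pl (scons True (nn G)) P.

Inductive ax : proc -> proc -> Prop :=
| ax_par_nil P : ax (Par P Nil) P
| ax_par_comm P Q : ax (Par P Q) (Par Q P)
| ax_par_assoc P Q R : ax (Par (Par P Q) R) (Par P (Par Q R))
| ax_bang P : ax (Bang P) (Par P (Bang P))
| ax_nu_nil : ax (Nu Nil) Nil
| ax_nu_swap P : ax (Nu (Nu P)) (Nu (Nu (ren swap01 P)))
| ax_scope P Q : ax (Nu (Par (ren S P) Q)) (Par P (Nu Q))
| ax_let p q P : ax (Let (Pair p q) P) (psub (scons q (scons p Name)) P).

(* The left process still has to communicate with the server of [c] where the
   right one holds the result of that communication ([r_msg], [r_rcv]).  The
   flag [true] allows structural axioms and closed servers. *)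
Inductive rel : bool -> env -> proc -> proc -> Prop :=
| r_nil b G : rel b G Nil Nil
| r_par b G P P' Q Q' : rel b G P P' -> rel b G Q Q' -> rel b G (Par P Q) (Par P' Q')
| r_bang b G P P' : rel b G P P' -> rel b G (Bang P) (Bang P')
| r_nu b G P P' : rel b (gup None G) P P' -> rel b G (Nu P) (Nu P')
| r_in b G s P P' :
    pd (nn G) s -> rel b (gup None G) P P' -> rel b G (In s P) (In s P')
| r_out b G s p P P' :
    pd (nn G) s -> pd (nn G) p -> rel b G P P' -> rel b G (Out s p P) (Out s p P')
| r_let b G p P P' :
    pd (nn G) p -> rel b (gup None (gup None G)) P P' -> rel b G (Let p P) (Let p P')
| r_msg b G c p R :
    G c = Some (KIn R) -> pd (nn G) p -> bpl G R ->
    rel b G (Out (Name c) p Nil) (psub (scons p Name) R)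
| r_rcv b G c T Q :
    G c = Some (KOut T) -> bpl G T -> bpl G Q ->
    rel b G (In (Name c) Q) (Nu (Par T Q))
| r_ax G P Q : ax P Q -> pl (nn G) P -> pl (nn G) Q -> rel true G P Q
| r_inst_in G R P P' :
    bpl G R -> rel false (gup (Some (KIn (ren (up S) R))) G) P P' ->
    rel true G (Nu (Par P (Bang (In (Name 0) (ren (up S) R))))) (Nu P')
| r_inst_out G T P P' :
    bpl G T -> rel false (gup (Some (KOut (ren (up S) T))) G) P P' ->
    rel true G (Nu (Par P (server 0 (ren (up S) T)))) (Nu P').

(* [f] acts on the left process and [g] on the right one, where the private
   channels do not occur; hence they only agree on the other names. *)
Definition sub_ok (f g : nat -> data) (G G' : env) : Prop := forall n,
  match G n with
  | None => f n = g n /\ pd (nn G') (f n)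
  | Some KRes => True
  | Some K => exists c, f n = Name c /\ G' c = Some (kmap f K)
  end.

Lemma nn_gup G n : scons True (nn G) n <-> nn (gup None G) n.
Proof. destruct n; unfold nn; simpl; [tauto|]. destruct (G n); split; congruence. Qed.

Lemma pl_gup G P : bpl G P <-> pl (nn (gup None G)) P.
Proof. split; intros H; eapply pl_mono; eauto; intros n; apply nn_gup. Qed.

Lemma psub_up_S f P : psub (dup (dup f)) (ren (up S) P) = ren (up S) (psub (dup f) P).
Proof. psub_solve. Qed.

Lemma psub_S f P : psub (dup f) (ren S P) = ren S (psub f P).
Proof. psub_solve. Qed.

Lemma kmap_up f K : kmap (dup f) (kmap (fun i => Name (S i)) K)
  = kmap (fun i => Name (S i)) (kmap f K).
Proof. destruct K; simpl; trivial; f_equal; psub_solve. Qed.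

Lemma kmap_ren_S R : psub (dup (fun i => Name (S i))) R = ren (up S) R.
Proof. psub_solve. Qed.

Lemma pd_shift G o p :
  pd (nn G) p -> pd (nn (gup o G)) (dsub (fun m => Name (S m)) p).
Proof.
  intros H; eapply pd_sub; eauto. intros n Hn; unfold nn in *; simpl. now rewrite Hn.
Qed.

Lemma sub_ok_up f g G G' o :
  sub_ok f g G G' ->
  sub_ok (dup f) (dup g) (gup o G)
    (gup (match o with None => None | Some K => Some (kmap (dup f) K) end) G').
Proof.
  intros H [|n]; simpl.
  - destruct o as [[R|T|]|]; simpl; eauto. split; [reflexivity|]. reflexivity.
  - specialize (H n). destruct (G n) as [K|].
    + assert (D : K = KRes \/ exists c, f n = Name c /\ G' c = Some (kmap f K))
        by (destruct K; auto).
      destruct D as [->|(c & E1 & E2)]; simpl; [trivial|].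
      assert (E : exists c0, dsub (fun m => Name (S m)) (f n) = Name c0 /\
         gup (match o with None => None | Some K => Some (kmap (dup f) K) end) G' c0
         = Some (kmap (dup f) (kmap (fun i => Name (S i)) K))).
      { exists (S c). rewrite E1; simpl. rewrite E2, kmap_up. auto. }
      destruct K; simpl in *; auto.
    + destruct H as [-> H]. split; auto. now apply pd_shift.
Qed.

Lemma sub_ok_gup f g G G' :
  sub_ok f g G G' -> sub_ok (dup f) (dup g) (gup None G) (gup None G').
Proof. apply (@sub_ok_up f g G G' None). Qed.

Lemma ax_sub f P Q : ax P Q -> ax (psub f P) (psub f Q).
Proof.
  destruct 1; simpl; try constructor.
  - replace (psub (dup (dup f)) (ren swap01 P))
      with (ren swap01 (psub (dup (dup f)) P)) by psub_solve.
    constructor.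
  - rewrite psub_S. constructor.
  - replace (psub f (psub (scons q (scons p Name)) P))
      with (psub (scons (dsub f q) (scons (dsub f p) Name)) (psub (dup (dup f)) P))
      by psub_solve.
    constructor.
Qed.

Lemma sub_ok_pd f g G G' p :
  sub_ok f g G G' -> pd (nn G) p -> pd (nn G') (dsub f p).
Proof.
  intros H Hp. eapply pd_sub; eauto. intros n Hn; specialize (H n).
  unfold nn in Hn; rewrite Hn in H; tauto.
Qed.

Lemma sub_ok_pl f g G G' P :
  sub_ok f g G G' -> pl (nn G) P -> pl (nn G') (psub f P).
Proof.
  intros H Hp. eapply pl_sub; eauto. intros n Hn; specialize (H n).
  unfold nn in Hn; rewrite Hn in H; tauto.
Qed.

Lemma sub_ok_eq f g G G' n : sub_ok f g G G' -> nn G n -> f n = g n.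
Proof. intros H Hn; specialize (H n). unfold nn in Hn; rewrite Hn in H; tauto. Qed.

Lemma sub_ok_bpl f g G G' P :
  sub_ok f g G G' -> bpl G P -> bpl G' (psub (dup f) P).
Proof.
  intros H Hp. apply pl_gup. apply pl_gup in Hp.
  eapply sub_ok_pl; eauto. apply sub_ok_gup, H.
Qed.

Lemma bpl_inst G P p : bpl G P -> pd (nn G) p -> pl (nn G) (psub (scons p Name) P).
Proof. intros H Hp; eapply pl_sub; eauto. intros [|n]; simpl; auto. Qed.

Lemma psub_inst f p P :
  psub f (psub (scons p Name) P) = psub (scons (dsub f p) Name) (psub (dup f) P).
Proof. psub_solve. Qed.

(** Used for the instantiations made by communications and for the shifts under new restrictions.
    Postponed communications stay postponed because [sub_ok] sends a private channel to one that
    carries the substituted resource. *)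
Lemma rel_sub b G P P' : rel b G P P' -> forall f g G', sub_ok f g G G' ->
  rel b G' (psub f P) (psub g P').
Proof.
  induction 1; intros f g G' Hs; simpl;
    repeat match goal with H : pd (nn ?G) ?p |- _ =>
      match goal with |- context [dsub g p] =>
        replace (dsub g p) with (dsub f p)
          by (eapply pd_ext_sub; [exact H | intros; eapply sub_ok_eq; eauto]) end end;
    try (constructor; eauto using sub_ok_pd;
         (apply IHrel || apply IHrel1 || apply IHrel2);
         eauto using sub_ok_gup; fail).
  - pose proof (Hs c) as Hc. rewrite H in Hc. destruct Hc as (c' & E1 & E2). rewrite E1.
    (* [f] and [g] may differ on private names only, and neither [p] nor [R] contains any. *)
    replace (psub g (psub (scons p Name) R)) with (psub f (psub (scons p Name) R)).
    + rewrite psub_inst. constructor; eauto using sub_ok_pd, sub_ok_bpl.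
    + eapply pl_ext_sub; [eapply bpl_inst; eauto|]. eauto using sub_ok_eq.
  - pose proof (Hs c) as Hc. rewrite H in Hc. destruct Hc as (c' & E1 & E2). rewrite E1.
    assert (E : forall X, bpl G X -> psub (dup g) X = psub (dup f) X).
    { intros X HX. symmetry. apply (pl_ext_sub X (nn (gup None G))); [apply pl_gup, HX|].
      intros n Hn; eapply sub_ok_eq, Hn. apply sub_ok_gup, Hs. }
    rewrite !E by auto. constructor; eauto using sub_ok_bpl.
  - replace (psub g Q) with (psub f Q).
    + constructor; eauto using ax_sub, sub_ok_pl.
    + eapply pl_ext_sub; eauto using sub_ok_eq.
  - rewrite psub_up_S. apply r_inst_in; [eauto using sub_ok_bpl|]. rewrite <- psub_up_S. apply IHrel.
    apply (@sub_ok_up _ _ _ _ (Some (KIn _)) Hs).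
  - unfold server; simpl.
    change (rel true G' (Nu (Par (psub (dup f) P)
      (server 0 (psub (dup (dup f)) (ren (up S) T))))) (Nu (psub (dup g) P'))).
    rewrite psub_up_S. apply r_inst_out; [eauto using sub_ok_bpl|]. rewrite <- psub_up_S. apply IHrel.
    apply (@sub_ok_up _ _ _ _ (Some (KOut _)) Hs).
Qed.

Lemma kmap_id K : kmap Name K = K.
Proof. destruct K; simpl; trivial; f_equal; apply psub_id, dup_id. Qed.

Lemma sub_ok_ext G G' : (forall n, G n = G' n) -> sub_ok Name Name G G'.
Proof.
  intros H n. destruct (G n) as [K|] eqn:E.
  - assert (exists c, Name n = Name c /\ G' c = Some (kmap Name K)).
    { exists n. rewrite kmap_id, <- H. auto. }
    destruct K; auto.
  - split; auto. simpl. unfold nn. congruence.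
Qed.

(** Environments are functions; pointwise equal ones are exchanged through the identity
    substitution, without extensionality. *)
Lemma rel_ext b G G' P P' :
  rel b G P P' -> (forall n, G n = G' n) -> rel b G' P P'.
Proof.
  intros H E. rewrite <- (@psub_id P Name), <- (@psub_id P' Name) by auto.
  eapply rel_sub; eauto using sub_ok_ext.
Qed.

Lemma rel_refl P : forall b G, pl (nn G) P -> rel b G P P.
Proof.
  induction P; intros b G H; simpl in H.
  - apply r_nil.
  - apply r_par; [apply IHP1 | apply IHP2]; apply H.
  - apply r_bang, IHP, H.
  - apply r_nu, IHP, pl_gup, H.
  - apply r_in; [apply H|]. apply IHP, pl_gup, H.
  - apply r_out; [apply H..|]. apply IHP, H.
  - apply r_let; [apply H|]. apply IHP, pl_gup. unfold bpl.
    eapply pl_mono; [apply H|]. intros [|n]; [simpl; trivial|]. apply nn_gup.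
Qed.

Lemma rel_weaken b G P P' : rel b G P P' -> rel true G P P'.
Proof. induction 1; eauto using rel. Qed.

Lemma sub_ok_S o G : sub_ok (fun n => Name (S n)) (fun n => Name (S n)) G (gup o G).
Proof.
  intros n. destruct (G n) as [K|] eqn:E.
  - assert (exists c, Name (S n) = Name c /\
       gup o G c = Some (kmap (fun i => Name (S i)) K)).
    { exists (S n). simpl. now rewrite E. }
    destruct K; auto.
  - split; auto. simpl. unfold nn; simpl. now rewrite E.
Qed.

Lemma pl_shift o G P : pl (nn G) P -> pl (nn (gup o G)) (ren S P).
Proof. intros H. eapply sub_ok_pl; eauto using sub_ok_S. Qed.

Lemma sub_ok_inst G p : pd (nn G) p -> sub_ok (scons p Name) (scons p Name) (gup None G) G.
Proof.
  intros H [|n]; simpl; auto.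
  destruct (G n) as [K|] eqn:E.
  - assert (exists c, Name n = Name c /\ G c =
       Some (kmap (scons p Name) (kmap (fun i => Name (S i)) K))).
    { exists n. split; auto. rewrite E. f_equal.
      destruct K; simpl; auto; f_equal; symmetry; psub_solve. }
    destruct K; simpl in *; auto.
  - simpl. unfold nn. auto.
Qed.

Lemma rel_inst b G p P P' : pd (nn G) p -> rel b (gup None G) P P' ->
  rel b G (psub (scons p Name) P) (psub (scons p Name) P').
Proof. intros Hp H. eapply rel_sub; eauto using sub_ok_inst. Qed.

Lemma rel_inst2 b G p q P P' : pd (nn G) p -> pd (nn G) q ->
  rel b (gup None (gup None G)) P P' ->
  rel b G (psub (scons q (scons p Name)) P) (psub (scons q (scons p Name)) P').
Proof.
  intros Hp Hq H.
  (* The two indices are instantiated one after the other; [q] is shifted over the one that still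
     waits for [p]. *)
  apply (@rel_inst b (gup None G) (dsub (fun n => Name (S n)) q)) in H;
    [|now apply pd_shift].
  apply (@rel_inst b G p) in H; auto.
  assert (E : forall X, psub (scons p Name) (psub (scons (dsub (fun n => Name (S n)) q) Name) X)
     = psub (scons q (scons p Name)) X).
  { intros X. psub_solve. }
  now rewrite !E in H.
Qed.
(** * An abstract machine *)

Definition cfg := (nat * list proc)%type.

(** Structural congruence oriented into a deterministic unfolding of a single thread, which is why
    unfoldings commute with all other moves. *)
Definition unf (X : proc) : option (nat * list proc) :=
  match X with
  | Nil => Some (0, [])
  | Par P Q => Some (0, [P; Q])
  | Bang P => Some (0, [P; Bang P])
  | Nu P => Some (1, [P])
  | Let (Pair p q) P => Some (0, [psub (scons q (scons p Name)) P])
  | _ => None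
  end.

Definition sh (d : nat) : proc -> proc := ren (Nat.add d).

(* The flag tells the unfolding of a thread ([true]) from a communication. *)
Inductive bstep : bool -> cfg -> cfg -> Prop :=
| bs_unf k L X M d Ys :
    Permutation L (X :: M) -> unf X = Some (d, Ys) ->
    bstep true (k, L) (d + k, Ys ++ map (sh d) M)
| bs_comm k L a p P Q M :
    Permutation L (Out (Name a) p P :: In (Name a) Q :: M) ->
    bstep false (k, L) (k, P :: psub (scons p Name) Q :: M).

(* [gr k k' r]: [r] sends the free name [n], which is [k + n] under [k]
   restrictions, to [k' + n], and is injective. *)
Inductive gr : nat -> nat -> (nat -> nat) -> Prop :=
| gr_id k : gr k k (fun n => n)
| gr_swap k : gr (2 + k) (2 + k) swap01
| gr_S k : gr k (S k) S
| gr_up k k' r : gr k k' r -> gr (S k) (S k') (up r)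
| gr_comp k k' k'' r s : gr k k' r -> gr k' k'' s -> gr k k'' (fun n => s (r n))
| gr_ext k k' r s : gr k k' r -> (forall n, r n = s n) -> gr k k' s.

Lemma gr_inj k k' r : gr k k' r -> forall m n, r m = r n -> m = n.
Proof.
  induction 1; intros m n E; auto.
  - destruct m as [|[|m]], n as [|[|n]]; simpl in E; congruence.
  - destruct m, n; simpl in E; try congruence. f_equal; apply IHgr; congruence.
  - apply IHgr; congruence.
Qed.

Lemma gr_free k k' r : gr k k' r -> forall n, r (k + n) = k' + n.
Proof.
  induction 1; intros n; simpl; auto; try congruence.
Qed.

Lemma gr_upn d k k' r : gr k k' r -> gr (d + k) (d + k') (upn d r).
Proof. intros H; induction d; simpl; auto. now apply gr_up. Qed.

Inductive ren_eq : cfg -> cfg -> Prop :=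
| re_i k k' r L L' :
    gr k k' r -> Permutation L' (map (ren r) L) -> ren_eq (k, L) (k', L').

Definition ceq : cfg -> cfg -> Prop := clos_refl_sym_trans cfg ren_eq.

Lemma ceq_refl C : ceq C C. Proof. apply rst_refl. Qed.
Lemma ceq_sym C D : ceq C D -> ceq D C. Proof. apply rst_sym. Qed.
Lemma ceq_trans C D E : ceq C D -> ceq D E -> ceq C E. Proof. apply rst_trans. Qed.

Lemma ceq_ren k k' r L L' :
  gr k k' r -> Permutation L' (map (ren r) L) -> ceq (k, L) (k', L').
Proof. intros. apply rst_step. econstructor; eauto. Qed.

Lemma map_ren_id L : map (ren (fun n => n)) L = L.
Proof. rewrite <- (map_id L) at 2. apply map_ext. intros; now apply ren_id. Qed.

Lemma ceq_perm k L L' : Permutation L L' -> ceq (k, L) (k, L').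
Proof.
  intros H. apply (ceq_ren k k (fun n => n)); [constructor|].
  rewrite map_ren_id. now symmetry.
Qed.

Lemma ceq_gc k L : ceq (k, L) (S k, map (ren S) L).
Proof. apply (ceq_ren _ _ S); [constructor | reflexivity]. Qed.

Definition expands : cfg -> cfg -> Prop :=
  clos_refl_trans cfg (fun C D => bstep true C D \/ ceq C D).

Definition reach : cfg -> cfg -> Prop :=
  clos_refl_trans cfg (fun C D => (exists b, bstep b C D) \/ ceq C D).

Lemma unf_ren r X : unf (ren r X) = match unf X with
  | None => None | Some (d, Ys) => Some (d, map (ren (upn d r)) Ys) end.
Proof.
  destruct X; try reflexivity.
  - rewrite ren_Nu. reflexivity.
  - destruct p; try reflexivity. simpl. do 3 f_equal. psub_solve.
Qed.

Lemma unf_d X d Ys : unf X = Some (d, Ys) -> d = 0 \/ d = 1.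
Proof.
  destruct X; simpl; try discriminate; try (intros [= <- _]; auto).
  destruct p; [discriminate|]. intros [= <- _]; auto.
Qed.

Lemma upn_add d r n : upn d r (d + n) = d + r n.
Proof. induction d; simpl; auto. Qed.

Lemma map_ren_comp r s L : map (ren s) (map (ren r) L) = map (ren (fun n => s (r n))) L.
Proof. rewrite map_map. apply map_ext. intros; apply ren_comp. Qed.

Lemma map_ren_ext r s L : (forall n, r n = s n) -> map (ren r) L = map (ren s) L.
Proof. intros H. apply map_ext. intros; now apply ren_ext. Qed.

Lemma map_sh_upn d r M :
  map (sh d) (map (ren r) M) = map (ren (upn d r)) (map (sh d) M).
Proof.
  unfold sh. rewrite !map_ren_comp. apply map_ren_ext. intros; now rewrite upn_add.
Qed.

Lemma bstep_perm b k L L' C : Permutation L' L -> bstep b (k, L) C -> bstep b (k, L') C.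
Proof. intros H B; inversion B; subst; econstructor; eauto using perm_trans. Qed.

Lemma bstep_ren b k L C k' r : gr k k' r -> bstep b (k, L) C ->
  exists D, bstep b (k', map (ren r) L) D /\ ren_eq C D.
Proof.
  intros G B; inversion B as [? ? ? ? ? ? HP HU|? ? ? ? ? ? ? HP]; subst;
    apply (Permutation_map (ren r)) in HP; simpl in HP.
  - eexists; split.
    + eapply bs_unf; [exact HP|]. rewrite unf_ren, HU. reflexivity.
    + apply re_i with (upn d r); [now apply gr_upn|].
      now rewrite map_app, map_sh_upn.
  - eexists; split.
    + eapply bs_comm. rewrite ren_Out, ren_In in HP. exact HP.
    + apply re_i with r; trivial. simpl.
      match goal with |- Permutation (_ :: ?x :: _) (_ :: ?y :: _) =>
        replace x with y by psub_solve end. reflexivity.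
Qed.

Lemma ren_Out_inv r X s p P : ren r X = Out s p P ->
  exists s' p' P', X = Out s' p' P' /\ s = dsub (fun n => Name (r n)) s'
    /\ p = dsub (fun n => Name (r n)) p' /\ P = ren r P'.
Proof. destruct X; try discriminate. intros [= <- <- <-]. eauto 8. Qed.

Lemma ren_In_inv r X s P : ren r X = In s P ->
  exists s' P', X = In s' P' /\ s = dsub (fun n => Name (r n)) s'
    /\ P = ren (up r) P'.
Proof. destruct X; try discriminate. rewrite ren_In. intros [= <- <-]. eauto 8. Qed.

(** Injectivity of [r] prevents the renaming from identifying two subjects and thereby creating a
    communication. *)
Lemma bstep_unren b k L D k' r : gr k k' r -> bstep b (k', map (ren r) L) D ->
  exists C, bstep b (k, L) C /\ ren_eq C D.
Proof.
  intros G B; inversion B as [? ? X M d Ys HP HU|? ? a p P Q M HP]; subst;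
    symmetry in HP; apply Permutation_map_inv in HP; destruct HP as (L0 & E & HP).
  - destruct L0 as [|X0 M0]; [discriminate|]. injection E as -> ->.
    rewrite unf_ren in HU. destruct (unf X0) as [[d0 Zs]|] eqn:HU0; [|discriminate].
    injection HU as <- <-. eexists; split.
    + eapply bs_unf; eauto.
    + apply re_i with (upn d0 r); [now apply gr_upn|].
      now rewrite map_app, map_sh_upn.
  - destruct L0 as [|X0 [|Y0 M0]]; try discriminate. simpl in E. injection E as E1 E2 ->.
    symmetry in E1, E2.
    apply ren_Out_inv in E1; destruct E1 as (s1 & p1 & P1 & -> & E1 & -> & ->).
    apply ren_In_inv in E2; destruct E2 as (s2 & Q2 & -> & E2 & ->).
    destruct s1 as [a1|], s2 as [a2|]; try discriminate.
    injection E1 as ->. injection E2 as E2. apply (gr_inj _ _ _ G) in E2; subst a2.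
    eexists; split.
    + eapply bs_comm; eauto.
    + apply re_i with r; trivial. simpl.
      match goal with |- Permutation (_ :: ?x :: _) (_ :: ?y :: _) =>
        replace x with y by psub_solve end. reflexivity.
Qed.

Lemma ren_eq_bstep b C D C' : ren_eq C D -> bstep b C C' ->
  exists D', bstep b D D' /\ ren_eq C' D'.
Proof.
  intros E B; inversion E as [k k' r L L' G HP]; subst.
  destruct (bstep_ren _ _ _ _ _ _ G B) as (D' & B' & E').
  exists D'; split; auto. eapply bstep_perm; eauto.
Qed.

Lemma ren_eq_bstep_inv b C D D' : ren_eq C D -> bstep b D D' ->
  exists C', bstep b C C' /\ ren_eq C' D'.
Proof.
  intros E B; inversion E as [k k' r L L' G HP]; subst.
  eapply bstep_unren; eauto. eapply bstep_perm; [symmetry|]; eauto.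
Qed.

Lemma ceq_bstep C D : ceq C D ->
  (forall b C', bstep b C C' -> exists D', bstep b D D' /\ ceq C' D') /\
  (forall b D', bstep b D D' -> exists C', bstep b C C' /\ ceq C' D').
Proof.
  induction 1 as [C D E|C|C D _ [IH1 IH2]|C D F _ [IH1 IH2] _ [IH3 IH4]].
  - split; intros b X B.
    + destruct (ren_eq_bstep _ _ _ _ E B) as (D' & ? & ?).
      exists D'; split; auto. now apply rst_step.
    + destruct (ren_eq_bstep_inv _ _ _ _ E B) as (D' & ? & ?).
      exists D'; split; auto. now apply rst_step.
  - split; eauto using ceq_refl.
  - split; intros b X B.
    + destruct (IH2 _ _ B) as (D' & ? & ?); eauto using ceq_sym.
    + destruct (IH1 _ _ B) as (D' & ? & ?); eauto using ceq_sym.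
  - split; intros b X B.
    + destruct (IH1 _ _ B) as (D' & B' & ?). destruct (IH3 _ _ B') as (F' & ? & ?).
      eauto using ceq_trans.
    + destruct (IH4 _ _ B) as (D' & B' & ?). destruct (IH2 _ _ B') as (F' & ? & ?).
      eauto using ceq_trans.
Qed.

Lemma perm_cons_cons (A : Type) (x y : A) L M : Permutation (x :: L) (y :: M) ->
  (x = y /\ Permutation L M) \/
  exists N, Permutation L (y :: N) /\ Permutation M (x :: N).
Proof.
  intros H.
  assert (I : List.In x (y :: M)) by (eapply Permutation_in; [exact H | now left]).
  destruct I as [->|I].
  - left; split; auto. eapply Permutation_cons_inv; eauto.
  - right. apply in_split in I. destruct I as (M1 & M2 & ->).
    exists (M1 ++ M2). split.
    + apply (Permutation_cons_inv (a := x)). rewrite H.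
      rewrite <- (Permutation_middle M1 M2 x). apply perm_swap.
    + symmetry. apply Permutation_middle.
Qed.

Lemma unf_sh d X e Ys : unf X = Some (e, Ys) ->
  unf (sh d X) = Some (e, map (ren (upn e (Nat.add d))) Ys).
Proof. intros H. unfold sh. now rewrite unf_ren, H. Qed.

Ltac perm_norm := simpl; repeat rewrite ?map_app, <- ?app_assoc; simpl;
  rewrite ?app_nil_r.
(** Cancels equal heads and otherwise rotates the right-hand list; the 60 rounds of [perm_solve] are
    a crude bound. *)
Ltac perm_step :=
  match goal with
  | |- Permutation ?A ?A => reflexivity
  | |- Permutation (?x :: _) (?x :: _) => apply perm_skip
  | |- Permutation (?x ++ _) (?x ++ _) => apply Permutation_app_head
  | |- Permutation _ (?y :: ?B) =>
      transitivity (B ++ [y]); [perm_norm | symmetry; apply Permutation_cons_append]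
  | |- Permutation _ (?y ++ ?B) =>
      transitivity (B ++ y); [perm_norm | apply Permutation_app_comm]
  end.
Ltac perm_solve := perm_norm; do 60 (try perm_step).

(* Two unfolded restrictions are created in either order: the results differ by
   [swap01]. *)
Lemma bstep_diamond C C1 b C' : bstep true C C1 -> bstep b C C' ->
  ceq C1 C' \/ exists E E', bstep b C1 E /\ bstep true C' E' /\ ceq E E'.
Proof.
  intros B1 B2.
  inversion B1 as [k L X M d Ys HP HU|]; subst.
  inversion B2 as [? ? Z N e Zs HP2 HU2|? ? a p P Q N HP2]; subst; rewrite HP in HP2.
  - apply perm_cons_cons in HP2. destruct HP2 as [[<- HN]|(N' & H1 & H2)].
    + left. rewrite HU in HU2. injection HU2 as <- <-. apply ceq_perm.
      apply Permutation_app_head. now apply Permutation_map.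
    + right. do 2 eexists. split; [|split].
      * eapply bs_unf; [|eapply unf_sh, HU2].
        rewrite H1. transitivity (sh d Z :: (Ys ++ map (sh d) N')); [perm_solve|].
        reflexivity.
      * eapply bs_unf; [|eapply unf_sh, HU].
        rewrite H2. transitivity (sh e X :: (Zs ++ map (sh e) N')); [perm_solve|].
        reflexivity.
      * apply ceq_ren with (if Nat.eqb (d + e) 2 then swap01 else fun n => n).
        -- apply unf_d in HU; apply unf_d in HU2.
           destruct HU as [-> | ->], HU2 as [-> | ->]; simpl; constructor.
        -- apply unf_d in HU; apply unf_d in HU2. unfold sh.
           rewrite !map_app, !map_ren_comp.
           etransitivity; [apply Permutation_app_swap_app|].
           repeat apply Permutation_app;
             (match goal with |- Permutation ?A ?B => replace A with B; [reflexivity|] end;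
              apply map_ren_ext; intros n;
              destruct HU as [-> | ->], HU2 as [-> | ->]; simpl; auto;
              destruct n as [|[|n]]; reflexivity).
  - assert (U1 : forall s q R, X <> Out s q R) by (intros s q R ->; discriminate).
    assert (U2 : forall s R, X <> In s R) by (intros s R ->; discriminate).
    apply perm_cons_cons in HP2. destruct HP2 as [[-> _]|(N1 & H1 & H2)];
      [now destruct (U1 (Name a) p P)|].
    symmetry in H2; apply perm_cons_cons in H2.
    destruct H2 as [[-> _]|(N2 & H2 & H3)]; [now destruct (U2 (Name a) Q)|].
    right. do 2 eexists. split; [|split].
    + eapply (bs_comm _ _ (d + a) (dsub (fun n => Name (d + n)) p) (sh d P)
        (ren (up (Nat.add d)) Q) (Ys ++ map (sh d) N2)).
      rewrite H1, H2. unfold sh. simpl. rewrite ren_Out, ren_In. perm_solve.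
    + eapply bs_unf; [|exact HU].
      rewrite H3. transitivity (X :: P :: psub (scons p Name) Q :: N2); [perm_solve|].
      reflexivity.
    + apply ceq_perm.
      replace (psub _ (ren (up (Nat.add d)) Q)) with (sh d (psub (scons p Name) Q))
        by (unfold sh; psub_solve).
      perm_solve.
Qed.

(** * Barbs and weak bisimulation of configurations *)

Definition is_barb (o : bool) (n : nat) (X : proc) : Prop :=
  if o then exists p P, X = Out (Name n) p P else exists P, X = In (Name n) P.

Definition cbarb (o : bool) (C : cfg) (n : nat) : Prop :=
  exists X, List.In X (snd C) /\ is_barb o (fst C + n) X.

Lemma is_barb_ren o k k' r n X : gr k k' r ->
  is_barb o (k + n) X <-> is_barb o (k' + n) (ren r X).
Proof.
  intros G. pose proof (gr_free _ _ _ G n) as E. destruct o; simpl; split.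
  - intros (p & P & ->). rewrite ren_Out; simpl; rewrite E; eauto.
  - intros (p & P & H). apply ren_Out_inv in H. destruct H as (s & q & Q & -> & H & _).
    destruct s as [a|]; [|discriminate]. injection H as H. rewrite <- E in H.
    apply (gr_inj _ _ _ G) in H. subst a; eauto.
  - intros (P & ->). rewrite ren_In; simpl; rewrite E; eauto.
  - intros (P & H). apply ren_In_inv in H. destruct H as (s & Q & -> & H & _).
    destruct s as [a|]; [|discriminate]. injection H as H. rewrite <- E in H.
    apply (gr_inj _ _ _ G) in H. subst a; eauto.
Qed.

Lemma ceq_barb o n C D : ceq C D -> cbarb o C n <-> cbarb o D n.
Proof.
  induction 1 as [C D E|C|C D _ IH|C D F _ IH1 _ IH2]; try tauto.
  inversion E as [k k' r L L' G HP]; subst. unfold cbarb; simpl. split.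
  - intros (X & HX & B). exists (ren r X). split.
    + rewrite HP. now apply in_map.
    + eapply is_barb_ren in B; eauto.
  - intros (X & HX & B). rewrite HP in HX. apply in_map_iff in HX.
    destruct HX as (Y & <- & HY). exists Y; split; auto. eapply is_barb_ren; eauto.
Qed.

Lemma unf_barb o n C D : bstep true C D -> cbarb o C n -> cbarb o D n.
Proof.
  intros B (X & HX & HB).
  inversion B as [k L Z M d Ys HP HU|]; subst. simpl in *. rewrite HP in HX.
  destruct HX as [->|HX].
  - destruct o; simpl in HB.
    + destruct HB as (p & P & ->); discriminate.
    + destruct HB as (P & ->); discriminate.
  - exists (sh d X). simpl; split.
    + apply in_or_app; right. now apply in_map.
    + assert (G : gr k (d + k) (Nat.add d)).
      { apply unf_d in HU. destruct HU as [-> | ->]; [apply gr_id | apply gr_S]. }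
      apply (is_barb_ren o _ _ _ n X G) in HB. exact HB.
Qed.

Lemma expands_refl C : expands C C. Proof. apply rt_refl. Qed.
Lemma expands_trans C D E : expands C D -> expands D E -> expands C E.
Proof. apply rt_trans. Qed.
Lemma expands_ceq C D : ceq C D -> expands C D.
Proof. intros; apply rt_step; auto. Qed.
Lemma expands_bstep C D : bstep true C D -> expands C D.
Proof. intros; apply rt_step; auto. Qed.
Lemma reach_refl C : reach C C. Proof. apply rt_refl. Qed.
Lemma reach_trans C D E : reach C D -> reach D E -> reach C E.
Proof. apply rt_trans. Qed.
Lemma reach_bstep b C D : bstep b C D -> reach C D.
Proof. intros; apply rt_step; eauto. Qed.
Lemma reach_expands C D : expands C D -> reach C D.
Proof.
  induction 1; eauto using reach_refl, reach_trans.
  apply rt_step. destruct H; eauto.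
Qed.

Lemma expands_barb o n C D : expands C D -> cbarb o C n -> cbarb o D n.
Proof.
  induction 1 as [C D [H|H]|C|]; auto.
  - intros B; eapply unf_barb; eauto.
  - apply (ceq_barb o n _ _ H).
Qed.

(* An unfolding never discards a behaviour, which makes bisimulation up to
   unfolding sound. *)
Lemma expands_strip C C0 : expands C C0 -> forall b C', bstep b C C' ->
  exists E, (bstep b C0 E \/ C0 = E) /\ expands C' E.
Proof.
  intros H; apply clos_rt_rt1n in H.
  induction H as [C|C C1 C0 HS H1 IH]; intros b C' B.
  - eauto using expands_refl.
  - destruct HS as [U|E].
    + destruct (bstep_diamond _ _ _ _ U B) as [E|(E & E' & B1 & U' & HE)].
      * exists C0; split; auto.
        apply expands_trans with C1; [apply expands_ceq, ceq_sym, E|].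
        now apply clos_rt1n_rt.
      * destruct (IH _ _ B1) as (F & HF & X). exists F; split; auto.
        apply expands_trans with E'; [now apply expands_bstep|].
        apply expands_trans with E; auto. now apply expands_ceq, ceq_sym.
    + destruct (ceq_bstep _ _ E) as [HE _].
      destruct (HE _ _ B) as (D' & B' & E').
      destruct (IH _ _ B') as (F & HF & X). exists F; split; auto.
      apply expands_trans with D'; auto. now apply expands_ceq.
Qed.

(** The clause for [ceq] lets a simulation be iterated along [reach], which interleaves [ceq] with
    steps. *)
Definition wsim (R : cfg -> cfg -> Prop) : Prop := forall C D, R C D ->
  (forall b C', bstep b C C' -> exists D', reach D D' /\ R C' D') /\
  (forall C', ceq C C' -> exists D', reach D D' /\ R C' D') /\
  (forall o n, cbarb o C n -> exists D', reach D D' /\ cbarb o D' n).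

(** Two simulations replace symmetry, because the eliminating relation is oriented and its two
    directions are proved differently. *)
Definition cbis (C D : cfg) : Prop :=
  exists R, wsim R /\ wsim (fun D C => R C D) /\ R C D.

Lemma wsim_reach R C D : wsim R -> R C D -> forall C', reach C C' ->
  exists D', reach D D' /\ R C' D'.
Proof.
  intros W H C' HR. revert D H. induction HR as [C C' [[b B]|E]|C|C C1 C2 _ IH1 _ IH2];
    intros D H.
  - destruct (W _ _ H) as (W1 & _). eauto.
  - destruct (W _ _ H) as (_ & W2 & _). eauto.
  - eauto using reach_refl.
  - destruct (IH1 _ H) as (D1 & R1 & H1). destruct (IH2 _ H1) as (D2 & R2 & H2).
    eauto using reach_trans.
Qed.

Lemma wsim_comp R S : wsim R -> wsim S -> wsim (fun C E => exists D, R C D /\ S D E).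
Proof.
  intros WR WS C E (D & HR & HS). destruct (WR _ _ HR) as (W1 & W2 & W3).
  repeat split.
  - intros b C' B. destruct (W1 _ _ B) as (D' & RD & HD).
    destruct (wsim_reach _ _ _ WS HS _ RD) as (E' & RE & HE). eauto.
  - intros C' B. destruct (W2 _ B) as (D' & RD & HD).
    destruct (wsim_reach _ _ _ WS HS _ RD) as (E' & RE & HE). eauto.
  - intros o n B. destruct (W3 _ _ B) as (D' & RD & HD).
    destruct (wsim_reach _ _ _ WS HS _ RD) as (E' & RE & HE).
    destruct (WS _ _ HE) as (_ & _ & W). destruct (W _ _ HD) as (E'' & ? & ?).
    eauto using reach_trans.
Qed.

Lemma cbis_sym C D : cbis C D -> cbis D C.
Proof. intros (R & W1 & W2 & H). exists (fun D C => R C D). auto. Qed.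

Lemma cbis_trans C D E : cbis C D -> cbis D E -> cbis C E.
Proof.
  intros (R & W1 & W2 & H) (S & W3 & W4 & H').
  exists (fun C E => exists D, R C D /\ S D E). split; [|split; eauto].
  - now apply wsim_comp.
  - intros X Y (D1 & H1 & H2).
    destruct (wsim_comp _ _ W4 W2 X Y) as (A1 & A2 & A3); [eauto|].
    repeat split; auto.
    + intros b C' B. destruct (A1 _ _ B) as (? & ? & ? & ? & ?); eauto.
    + intros C' B. destruct (A2 _ B) as (? & ? & ? & ? & ?); eauto.
Qed.

Lemma cbis_reach C D C' : cbis C D -> reach C C' -> exists D', reach D D' /\ cbis C' D'.
Proof.
  intros (R & W1 & W2 & H) HR. destruct (wsim_reach _ _ _ W1 H _ HR) as (D' & ? & ?).
  exists D'; split; auto. exists R; auto.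
Qed.

Lemma cbis_barb C D o n : cbis C D -> cbarb o C n -> exists D', reach D D' /\ cbarb o D' n.
Proof. intros (R & W1 & W2 & H) HR. now apply (W1 _ _ H). Qed.

(** The witness is [expands] itself: a move of [C] survives the unfolding by [expands_strip], and a
    move of [D] is reached from [C] through it. *)
Lemma cbis_expands C D : expands C D -> cbis C D.
Proof.
  intros H. exists expands. split; [|split; trivial]; clear; intros C D H;
    (split; [|split]).
  - intros b C' B. destruct (expands_strip _ _ H _ _ B) as (E & [B'|<-] & X);
      eauto using reach_refl, reach_bstep.
  - intros C' E. exists D; split; [apply reach_refl|].
    eapply expands_trans; [apply expands_ceq, ceq_sym|]; eauto.
  - intros o n B. eauto using reach_refl, expands_barb.
  - intros b C' B. exists C'. split; [|apply expands_refl].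
    eapply reach_trans; [apply reach_expands|eapply reach_bstep]; eauto.
  - intros C' E. exists C'. split; [|apply expands_refl].
    eapply reach_trans; apply reach_expands; eauto using expands_ceq.
  - intros o n B. eauto using reach_expands.
Qed.

Lemma cbis_refl C : cbis C C.
Proof. apply cbis_expands, expands_refl. Qed.
(** * The elimination of private resources is a bisimulation *)

Inductive hd (G : env) : proc -> proc -> Prop :=
| hd_nil : hd G Nil Nil
| hd_par P P' Q Q' : rel true G P P' -> rel true G Q Q' -> hd G (Par P Q) (Par P' Q')
| hd_bang P P' : rel true G P P' -> hd G (Bang P) (Bang P')
| hd_nu P P' : rel true (gup None G) P P' -> hd G (Nu P) (Nu P')
| hd_in s P P' : pd (nn G) s -> rel true (gup None G) P P' -> hd G (In s P) (In s P')
| hd_out s p P P' :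
    pd (nn G) s -> pd (nn G) p -> rel true G P P' -> hd G (Out s p P) (Out s p P')
| hd_let p P P' :
    pd (nn G) p -> rel true (gup None (gup None G)) P P' -> hd G (Let p P) (Let p P').

Inductive leaf (G : env) : proc -> proc -> Prop :=
| leaf_msg c p R : G c = Some (KIn R) -> pd (nn G) p -> bpl G R ->
    leaf G (Out (Name c) p Nil) (psub (scons p Name) R)
| leaf_rcv c T Q : G c = Some (KOut T) -> bpl G T -> bpl G Q ->
    leaf G (In (Name c) Q) (Nu (Par T Q)).

(** This dichotomy is the purpose of the flag: with neither axioms nor closed servers at the root, a
    pair has equal heads or is a postponed communication. *)
Lemma rel_false_cases G X X' : rel false G X X' -> hd G X X' \/ leaf G X X'.
Proof.
  intros H; inversion H; subst; (left; constructor; eauto using rel_weaken; fail)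
    || (right; constructor; auto).
Qed.

Lemma sub_ok_pd_eq f g G G' p : sub_ok f g G G' -> pd (nn G) p -> dsub f p = dsub g p.
Proof. intros H Hp. eapply pd_ext_sub; eauto using sub_ok_eq. Qed.

Lemma hd_sub f g G G' X X' : sub_ok f g G G' -> hd G X X' -> hd G' (psub f X) (psub g X').
Proof.
  intros Hs H; inversion H; subst; simpl;
    repeat match goal with HH : pd (nn G) ?p |- _ =>
      rewrite <- (sub_ok_pd_eq _ _ _ _ _ Hs HH) by auto; revert HH end; intros;
    constructor; eauto using sub_ok_pd, rel_sub, sub_ok_gup.
Qed.

Lemma leaf_sub f g G G' X X' :
  sub_ok f g G G' -> leaf G X X' -> leaf G' (psub f X) (psub g X').
Proof.
  intros Hs H. 
  assert (R : rel false G X X').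
  { inversion H; subst; [eapply r_msg | eapply r_rcv]; eauto. }
  (* The result could a priori be an [hd] pair; its subject, being private, excludes that. *)
  pose proof (rel_sub _ _ _ _ R _ _ _ Hs) as R'.
  inversion H as [c p R0 Hc Hp HR|c T Q Hc HT HQ]; subst; simpl in *;
    pose proof (Hs c) as Hc'; rewrite Hc in Hc'; destruct Hc' as (c' & E1 & E2);
    rewrite E1 in *; apply rel_false_cases in R'; destruct R' as [R'|R']; auto;
    exfalso; inversion R'; subst; simpl in *; unfold nn in *; congruence.
Qed.

Lemma hd_refl G X : pl (nn G) X -> hd G X X.
Proof.
  intros H. pose proof (rel_refl X false G H) as R.
  apply rel_false_cases in R. destruct R as [R|R]; auto.
  exfalso; inversion R; subst; simpl in H; unfold nn in H; intuition congruence.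
Qed.

Fixpoint gupn (d : nat) (G : env) : env :=
  match d with 0 => G | S d => gup None (gupn d G) end.

Lemma hd_unf G X X' : hd G X X' ->
  match unf X, unf X' with
  | None, None => True
  | Some (d, Ys), Some (d', Ys') => d = d' /\ Forall2 (rel true (gupn d G)) Ys Ys'
  | _, _ => False
  end.
Proof.
  intros H; inversion H; subst; simpl; auto using rel.
  destruct p; auto. split; auto. constructor; auto. simpl in *.
  apply rel_inst2; tauto.
Qed.

(* The threads of a pair of configurations: [TL] a server or a copy of one, and
   [TW w] a copy that has created [w], have no counterpart on the right; [TH],
   [TM] and [TN] carry the right thread, related by [hd], [leaf] and [rel]. *)
Inductive tag : Type := TL | TW (w : nat) | TH (X : proc) | TM (X : proc) | TN (X : proc).

Definition entry := (proc * tag)%type.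

Definition lo (G : env) (X : proc) : Prop :=
  (exists c R, G c = Some (KIn R) /\ (X = Bang (In (Name c) R) \/ X = In (Name c) R)) \/
  (exists c T, G c = Some (KOut T) /\
     (X = server c T \/ X = Nu (Out (Name (S c)) (Name 0) T))).

Definition wt (G : env) (w : nat) (X : proc) : Prop :=
  G w = Some KRes /\
  exists c T, G c = Some (KOut T) /\
    X = Out (Name c) (Name w) (psub (scons (Name w) Name) T).

Definition eok (G : env) (e : entry) : Prop :=
  match snd e with
  | TL => lo G (fst e)
  | TW w => wt G w (fst e)
  | TH X' => hd G (fst e) X'
  | TM X' => leaf G (fst e) X'
  | TN X' => rel true G (fst e) X'
  end.

Definition right1 (e : entry) : list proc :=
  match snd e with TL | TW _ => [] | TH X | TM X | TN X => [X] end.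
Definition rights (E : list entry) : list proc := flat_map right1 E.
Definition wn1 (e : entry) : list nat := match snd e with TW w => [w] | _ => [] end.
Definition wns (E : list entry) : list nat := flat_map wn1 E.
Definition tm1 (e : entry) : nat := match snd e with TM _ => 1 | _ => 0 end.
Definition tms (E : list entry) : nat := list_sum (map tm1 E).
Definition tn1 (e : entry) : nat := match snd e with TN _ => 1 | _ => 0 end.
Definition tns (E : list entry) : nat := list_sum (map tn1 E).

Definition emap (f g : nat -> data) (e : entry) : entry :=
  (psub f (fst e),
   match snd e with
   | TL => TL
   | TW w => TW (match f w with Name w' => w' | Pair _ _ => 0 end)
   | TH X => TH (psub g X) | TM X => TM (psub g X) | TN X => TN (psub g X)
   end).

Definition srv (c : nat) (K : kind) : option proc :=
  match K with
  | KIn R => Some (Bang (In (Name c) R))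
  | KOut T => Some (server c T)
  | KRes => None
  end.

Definition kpl (G : env) (K : kind) : Prop :=
  match K with KIn R | KOut R => bpl G R | KRes => True end.

(** [c < k] hides private channels under the restrictions, where they give no barb. The permanent
    presence of the server is what allows a postponed communication at any time. *)
Definition env_ok (k : nat) (G : env) (E : list entry) : Prop :=
  forall c K, G c = Some K -> c < k /\ kpl G K /\
    forall X, srv c K = Some X -> List.In (X, TL) E.

(** By [NoDup], an early name belongs to a single copy of a server and can be relocated alone. *)
Definition wf (k : nat) (G : env) (E : list entry) : Prop :=
  env_ok k G E /\ Forall (eok G) E /\ NoDup (wns E).

Lemma rights_perm E E' : Permutation E E' -> Permutation (rights E) (rights E').
Proof. apply Permutation_flat_map. Qed.

Lemma wns_perm E E' : Permutation E E' -> Permutation (wns E) (wns E').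
Proof. apply Permutation_flat_map. Qed.

Lemma list_sum_perm l l' : Permutation l l' -> list_sum l = list_sum l'.
Proof. induction 1; simpl; lia. Qed.

Lemma tns_perm E E' : Permutation E E' -> tns E = tns E'.
Proof. intros H. now apply list_sum_perm, Permutation_map. Qed.

Lemma tms_perm E E' : Permutation E E' -> tms E = tms E'.
Proof. intros H. now apply list_sum_perm, Permutation_map. Qed.

Lemma wf_perm k G E E' : Permutation E E' -> wf k G E -> wf k G E'.
Proof.
  intros H (H1 & H2 & H3). split; [|split].
  - intros c K HK. destruct (H1 c K HK) as (? & ? & HX). repeat split; auto.
    intros X HS. rewrite <- H. auto.
  - now rewrite <- H.
  - eapply Permutation_NoDup; [|exact H3]. now apply wns_perm.
Qed.

Lemma wns_app E E' : wns (E ++ E') = wns E ++ wns E'.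
Proof. apply flat_map_app. Qed.
Lemma rights_app E E' : rights (E ++ E') = rights E ++ rights E'.
Proof. apply flat_map_app. Qed.
Lemma tns_app E E' : tns (E ++ E') = tns E + tns E'.
Proof. unfold tns. now rewrite map_app, list_sum_app. Qed.
Lemma tms_app E E' : tms (E ++ E') = tms E + tms E'.
Proof. unfold tms. now rewrite map_app, list_sum_app. Qed.

Lemma wf_replace k G es es' E :
  wf k G (es ++ E) -> (forall X, List.In (X, TL) es -> List.In (X, TL) es') ->
  wns es' = [] -> Forall (eok G) es' -> wf k G (es' ++ E).
Proof.
  intros (H1 & H2 & H3) HT HW HF. split; [|split].
  - intros c K HK. destruct (H1 c K HK) as (? & ? & HX). repeat split; auto.
    intros X HS. apply HX in HS. apply in_app_iff in HS. apply in_app_iff.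
    destruct HS; auto.
  - apply Forall_app in H2. apply Forall_app; tauto.
  - rewrite wns_app in *. rewrite HW. simpl.
    eapply NoDup_app_remove_l; eauto.
Qed.

Lemma lo_sub f g G G' X : sub_ok f g G G' -> lo G X -> lo G' (psub f X).
Proof.
  intros Hs [(c & R & Hc & HX)|(c & T & Hc & HX)]; pose proof (Hs c) as H;
    rewrite Hc in H; destruct H as (c' & E1 & E2); simpl in E2.
  - left. exists c', (psub (dup f) R). split; auto.
    destruct HX as [-> | ->]; simpl; rewrite E1; auto.
  - right. exists c', (psub (dup f) T). split; auto.
    destruct HX as [-> | ->]; unfold server; simpl; rewrite E1; auto.
Qed.

Lemma wt_sub f g G G' w w' X : sub_ok f g G G' -> wt G w X ->
  f w = Name w' -> G' w' = Some KRes -> wt G' w' (psub f X).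
Proof.
  intros Hs (Hw & c & T & Hc & ->) E Hw'. split; auto.
  pose proof (Hs c) as H; rewrite Hc in H; destruct H as (c' & E1 & E2); simpl in E2.
  exists c', (psub (dup f) T). split; auto. simpl. rewrite psub_inst; simpl. now rewrite E, E1.
Qed.

Lemma rights_emap f g E : rights (map (emap f g) E) = map (psub g) (rights E).
Proof.
  induction E as [|[X t] E IH]; simpl; auto. rewrite map_app, <- IH. f_equal.
  now destruct t.
Qed.

Lemma fst_emap f g E : map fst (map (emap f g) E) = map (psub f) (map fst E).
Proof. rewrite !map_map. now apply map_ext. Qed.

Lemma tns_emap f g E : tns (map (emap f g) E) = tns E.
Proof.
  unfold tns. rewrite map_map. f_equal. apply map_ext. now intros [X []].
Qed.

Lemma tms_emap f g E : tms (map (emap f g) E) = tms E.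
Proof.
  unfold tms. rewrite map_map. f_equal. apply map_ext. now intros [X []].
Qed.

(** Early names occur in no related pair, so the left may relocate one of them while the right is
    merely shifted. *)
Lemma sub_ok_move f G :
  (forall c R, G c = Some R -> kpl G R) ->
  (forall n, G n <> Some KRes -> f n = Name (S n)) ->
  sub_ok f (fun n => Name (S n)) G (gup None G).
Proof.
  intros HK Hf n.
  assert (EQ : forall X, bpl G X -> psub (dup (fun i => Name (S i))) X = psub (dup f) X).
  { intros X HX. eapply pl_ext_sub; [exact HX|]. intros [|m] Hm; simpl; auto.
    simpl in Hm. unfold nn in Hm. rewrite Hf by congruence. reflexivity. }
  destruct (G n) as [K|] eqn:E.
  - assert (K <> KRes -> exists c, f n = Name c /\ gup None G c = Some (kmap f K)).
    { intros NK. exists (S n). rewrite Hf by congruence. split; auto. simpl. rewrite E.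
      specialize (HK _ _ E). destruct K; simpl in *; try congruence; now rewrite EQ. }
    destruct K; trivial; apply H; congruence.
  - rewrite Hf by congruence. split; auto. simpl. unfold nn; simpl. now rewrite E.
Qed.

Lemma bpl_shift o G P : bpl G P -> bpl (gup o G) (ren (up S) P).
Proof.
  intros H. rewrite <- kmap_ren_S. eapply sub_ok_bpl; eauto using sub_ok_S.
Qed.

(** Covers both the plain shift under a new restriction and the relocation of an early name whose
    copy has just left [E]: [f] is free on the [KRes] names outside [wns E]. *)
Lemma wf_up f g o k G es E :
  wf k G E -> sub_ok f g G (gup o G) ->
  (forall c, G c <> None -> G c <> Some KRes -> f c = Name (S c)) ->
  (forall w, List.In w (wns E) -> f w = Name (S w)) ->
  (forall K, o = Some K -> kpl (gup o G) K /\
     forall X, srv 0 K = Some X -> List.In (X, TL) es) ->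
  Forall (eok (gup o G)) es ->
  NoDup (wns es ++ map S (wns E)) ->
  wf (S k) (gup o G) (es ++ map (emap f g) E).
Proof.
  intros (H1 & H2 & H3) Hs Hf Hw Ho He HN. split; [|split].
  - intros [|c] K; simpl.
    + intros HK. destruct (Ho K HK) as [HK' HX]. split; [lia|]. split; auto.
      intros X HS. apply in_app_iff; left; auto.
    + destruct (G c) as [K0|] eqn:E0; [|discriminate]. intros [= <-].
      destruct (H1 c K0 E0) as (Hk & Hp & HX). split; [lia|]. split.
      * destruct K0; simpl in *; auto; rewrite kmap_ren_S; now apply bpl_shift.
      * intros X HS. apply in_app_iff; right. apply in_map_iff.
        assert (NK : K0 <> KRes) by (intros ->; discriminate).
        assert (Ef : f c = Name (S c)) by (apply Hf; congruence).
        assert (KE : kmap f K0 = kmap (fun i => Name (S i)) K0).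
        { specialize (Hs c). rewrite E0 in Hs.
          assert (exists c0, f c = Name c0 /\ gup o G c0 = Some (kmap f K0))
            by (destruct K0; auto; congruence).
          destruct H as (c0 & E1 & E2). rewrite Ef in E1. injection E1 as <-.
          simpl in E2. rewrite E0 in E2. now injection E2. }
        rewrite <- KE in HS.
        destruct K0 as [R|T|]; simpl in HS; [| |discriminate]; injection HS as <-.
        -- exists (Bang (In (Name c) R), TL). split; [|now apply HX].
           unfold emap; simpl. now rewrite Ef.
        -- exists (server c T, TL). split; [|now apply HX].
           unfold emap, server; simpl. now rewrite Ef.
  - apply Forall_app; split; auto. apply Forall_map.
    rewrite Forall_forall in *. intros [X t] HE. pose proof (H2 _ HE) as HX.
    unfold eok in *; simpl in *. destruct t; simpl in *;
      eauto using lo_sub, hd_sub, leaf_sub, rel_sub.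
    assert (Ew : f w = Name (S w)).
    { apply Hw. unfold wns. apply in_flat_map. exists (X, TW w). simpl; auto. }
    rewrite Ew. eapply wt_sub; eauto. simpl. destruct HX as [-> _]. reflexivity.
  - rewrite wns_app. replace (wns (map (emap f g) E)) with (map S (wns E)); auto.
    clear - Hw. induction E as [|[X t] E IH]; simpl in *; auto.
    rewrite map_app. destruct t; simpl in *; auto. rewrite IH by auto.
    now rewrite Hw by auto.
Qed.

Notation eS := (emap (fun n => Name (S n)) (fun n => Name (S n))).

Lemma wf_shift o k G es E :
  wf k G E ->
  (forall K, o = Some K -> kpl (gup o G) K /\
     forall X, srv 0 K = Some X -> List.In (X, TL) es) ->
  Forall (eok (gup o G)) es -> NoDup (wns es ++ map S (wns E)) ->
  wf (S k) (gup o G) (es ++ map eS E).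
Proof. intros. apply wf_up; auto using sub_ok_S. Qed.

Lemma wf_shift_None k G es E :
  wf k G E -> wns es = [] -> Forall (eok (gup None G)) es ->
  wf (S k) (gup None G) (es ++ map eS E).
Proof.
  intros W H1 H2. apply wf_shift; auto; try congruence.
  rewrite H1. simpl. destruct W as (_ & _ & W).
  apply FinFun.Injective_map_NoDup; auto. intros x y; congruence.
Qed.

(** * Unfolding related threads until each pair is [hd] or [leaf] *)

Lemma map_sh0 M : map (sh 0) M = M.
Proof. apply map_ren_id. Qed.

Lemma ex_unf0 k L X M Ys L2 : Permutation L (X :: M) -> unf X = Some (0, Ys) ->
  Permutation L2 (Ys ++ M) -> expands (k, L) (k, L2).
Proof.
  intros HP HU H2. eapply expands_trans.
  - apply expands_bstep. exact (bs_unf k _ _ _ _ _ HP HU).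
  - apply expands_ceq, ceq_perm. rewrite map_sh0. now symmetry.
Qed.

Lemma ex_unf1 k L X M Ys L2 : Permutation L (X :: M) -> unf X = Some (1, Ys) ->
  Permutation L2 (Ys ++ map (ren S) M) -> expands (k, L) (S k, L2).
Proof.
  intros HP HU H2. eapply expands_trans.
  - apply expands_bstep. exact (bs_unf k _ _ _ _ _ HP HU).
  - apply expands_ceq, ceq_perm. now symmetry.
Qed.

Lemma ex_perm k L L' : Permutation L L' -> expands (k, L) (k, L').
Proof. intros. now apply expands_ceq, ceq_perm. Qed.

(** Both sides of an axiom unfold to common threads, so that an axiom costs no communication and its
    residues can be paired with themselves. *)
Lemma ax_join X X' : ax X X' -> forall G, pl (nn G) X -> pl (nn G) X' ->
  exists d Ys, Forall (pl (nn (gupn d G))) Ys /\ forall k L,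
    expands (k, X :: L) (d + k, Ys ++ map (sh d) L) /\
    expands (k, X' :: L) (d + k, Ys ++ map (sh d) L).
Proof.
  destruct 1; intros G H H'; simpl in H, H'.
  - exists 0, [P]. split; [intuition|]. intros k L; rewrite map_sh0; simpl; split.
    + apply expands_trans with (k, P :: Nil :: L).
      * eapply ex_unf0; reflexivity.
      * eapply (ex_unf0 _ _ Nil); [apply perm_swap|reflexivity|reflexivity].
    + apply expands_refl.
  - exists 0, [P; Q]. split; [intuition|]. intros k L; rewrite map_sh0; simpl; split.
    + eapply ex_unf0; reflexivity.
    + eapply (ex_unf0 _ _ (Par Q P)); [reflexivity..|]. apply perm_swap.
  - exists 0, [P; Q; R]. split; [intuition|]. intros k L; rewrite map_sh0; simpl; split.
    + apply expands_trans with (k, Par P Q :: R :: L); eapply ex_unf0; reflexivity.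
    + apply expands_trans with (k, P :: Par Q R :: L); [eapply ex_unf0; reflexivity|].
      eapply (ex_unf0 _ _ (Par Q R)); [apply perm_swap | reflexivity | perm_solve].
  - exists 0, [P; Bang P]. split; [intuition|]. intros k L; rewrite map_sh0; simpl; split;
      eapply ex_unf0; reflexivity.
  - exists 1, []. split; [constructor|]. intros k L; simpl; split.
    + apply expands_trans with (S k, Nil :: map (ren S) L).
      * eapply ex_unf1; reflexivity.
      * eapply ex_unf0; reflexivity.
    + apply expands_trans with (k, L).
      * eapply ex_unf0; reflexivity.
      * apply expands_ceq, ceq_gc.
  - exists 2, [P]. split.
    + constructor; auto. eapply pl_mono; eauto.
      intros [|[|n]]; simpl; unfold nn; simpl; auto. intros E. now rewrite E.
    + intros k L; simpl. 
      assert (E : map (sh 2) L = map (ren S) (map (ren S) L)) by now rewrite map_ren_comp.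
      split.
      * apply expands_trans with (S k, Nu P :: map (ren S) L); [eapply ex_unf1; reflexivity|].
        eapply ex_unf1; [reflexivity..|]. now rewrite E.
      * apply expands_trans with (S k, Nu (ren swap01 P) :: map (ren S) L);
          [eapply ex_unf1; reflexivity|].
        apply expands_trans with (S (S k), ren swap01 P :: map (sh 2) L).
        -- eapply ex_unf1; [reflexivity..|]. now rewrite E.
        -- apply expands_ceq. apply (ceq_ren _ _ swap01); [apply gr_swap|]. simpl.
           rewrite ren_comp, ren_id by now intros [|[|]].
           unfold sh. rewrite map_ren_comp. reflexivity.
  - exists 1, [ren S P; Q]. split.
    + constructor; [|constructor; [|constructor]].
      * now apply pl_shift.
      * now apply pl_gup.
    + intros k L; simpl; split.
      * apply expands_trans with (S k, Par (ren S P) Q :: map (ren S) L);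
          [eapply ex_unf1; reflexivity|].
        eapply ex_unf0; reflexivity.
      * apply expands_trans with (k, P :: Nu Q :: L); [eapply ex_unf0; reflexivity|].
        eapply (ex_unf1 _ _ (Nu Q)); [apply perm_swap | reflexivity |].
        simpl. apply perm_swap.
  - exists 0, [psub (scons q (scons p Name)) P]. split; [auto|].
    intros k L; rewrite map_sh0; simpl; split.
    + eapply ex_unf0; reflexivity.
    + apply expands_refl.
Qed.

Definition eSn (d : nat) : entry -> entry :=
  emap (fun n => Name (d + n)) (fun n => Name (d + n)).

Lemma wf_shiftn d k G E : wf k G E -> wf (d + k) (gupn d G) (map (eSn d) E).
Proof.
  intros W. induction d; simpl.
  - replace (map (eSn 0) E) with E; auto. symmetry. rewrite <- (map_id E) at 2.
    apply map_ext. intros [X t]. unfold eSn, emap; simpl.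
    rewrite psub_id by auto. f_equal. destruct t; simpl; rewrite ?psub_id; auto.
  - apply (wf_shift_None _ _ [] _) in IHd; simpl; auto.
    simpl in IHd. replace (map (eSn (S d)) E) with (map eS (map (eSn d) E)); auto.
    rewrite map_map. apply map_ext. intros [X t]. unfold eSn, emap; simpl.
    rewrite psub_comp. f_equal. destruct t; simpl; rewrite ?psub_comp; auto.
Qed.

Lemma wf_tail k G e E : wf k G (e :: E) -> snd e <> TL -> wf k G E.
Proof.
  intros W H. apply (wf_replace k G [e] [] E); auto.
  intros X [E1|[]]. subst e. now destruct H.
Qed.

Lemma wf_cons k G e E : wf k G E -> wn1 e = [] -> eok G e -> wf k G (e :: E).
Proof.
  intros W Hw He. apply (wf_replace k G [] [e] E); simpl; rewrite ?app_nil_r; auto.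
Qed.

Lemma tns_same es : tns (map (fun X => (X, TH X)) es) = 0.
Proof. induction es; simpl; auto. Qed.
Lemma tms_same es : tms (map (fun X => (X, TH X)) es) = 0.
Proof. induction es; simpl; auto. Qed.
Lemma rights_same es : rights (map (fun X => (X, TH X)) es) = es.
Proof. induction es; simpl; auto. now f_equal. Qed.
Lemma fst_same es : map fst (map (fun X => (X, TH X)) es) = es.
Proof. induction es; simpl; auto. now f_equal. Qed.
Lemma wns_same es : wns (map (fun X => (X, TH X)) es) = [].
Proof. induction es; simpl; auto. Qed.

Lemma wf_add k G es E : wf k G E -> wns es = [] -> Forall (eok G) es -> wf k G (es ++ E).
Proof.
  intros W H1 H2. apply (wf_replace k G [] es E); auto; now intros X [].
Qed.

Lemma wf_add_same k G Ys E :
  wf k G E -> Forall (pl (nn G)) Ys -> wf k G (map (fun X => (X, TH X)) Ys ++ E).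
Proof.
  intros W H. apply wf_add; auto using wns_same. apply Forall_map.
  eapply Forall_impl; [|exact H]. intros X HX. now apply hd_refl.
Qed.

Lemma rel_false_entry G X X' : rel false G X X' ->
  exists t, eok G (X, t) /\ right1 (X, t) = [X'] /\ wn1 (X, t) = [] /\ tn1 (X, t) = 0.
Proof.
  intros H. apply rel_false_cases in H. destruct H.
  - exists (TH X'); auto.
  - exists (TM X'); auto.
Qed.

(** The count of [TN] entries decreases because the body of a closed server is related at flag
    [false], which yields a [TH] or [TM] entry directly. *)
Lemma sync_one k G X X' E : wf k G ((X, TN X') :: E) -> exists k2 G2 E2,
  wf k2 G2 E2 /\ tns E2 = tns E /\
  expands (k, X :: map fst E) (k2, map fst E2) /\
  expands (k, X' :: rights E) (k2, rights E2).
Proof.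
  intros W. assert (R : rel true G X X').
  { destruct W as (_ & W & _). now inversion W. }
  apply wf_tail in W; [|discriminate].
  assert (HD : hd G X X' \/ leaf G X X' -> exists k2 G2 E2,
    wf k2 G2 E2 /\ tns E2 = tns E /\
    expands (k, X :: map fst E) (k2, map fst E2) /\
    expands (k, X' :: rights E) (k2, rights E2)).
  { intros [H|H].
    - exists k, G, ((X, TH X') :: E).
      split; [now apply wf_cons | split; [reflexivity | split; apply expands_refl]].
    - exists k, G, ((X, TM X') :: E).
      split; [now apply wf_cons | split; [reflexivity | split; apply expands_refl]]. }
  (* Common to both sorts of closed server: the restricted name becomes private and the server
     becomes a [TL] thread. *)
  assert (INST : forall K P P' B, X = Nu (Par P B) -> X' = Nu P' -> srv 0 K = Some B ->
    lo (gup (Some K) G) B -> kpl (gup (Some K) G) K -> rel false (gup (Some K) G) P P' ->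
    exists k2 G2 E2, wf k2 G2 E2 /\ tns E2 = tns E /\
    expands (k, X :: map fst E) (k2, map fst E2) /\
    expands (k, X' :: rights E) (k2, rights E2)).
  { intros K P P' B -> -> HB HL HK HR.
    destruct (rel_false_entry _ _ _ HR) as (t & Ht & Hr & Hw & Hn).
    exists (S k), (gup (Some K) G), ([(B, TL); (P, t)] ++ map eS E). split; [|split; [|split]].
    - apply wf_shift; auto.
      + intros K' [= <-]. split; auto. intros Y HY. rewrite HB in HY.
        injection HY as <-. now left.
      + simpl. destruct W as (_ & _ & W). rewrite Hw. simpl.
        apply FinFun.Injective_map_NoDup; auto. intros x y; congruence.
    - rewrite tns_app, tns_emap. unfold tns; simpl. now rewrite Hn.
    - rewrite map_app, fst_emap. simpl.
      apply expands_trans with (S k, Par P B :: map (ren S) (map fst E)).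
      + eapply ex_unf1; reflexivity.
      + eapply ex_unf0; [reflexivity..|]. simpl. apply perm_swap.
    - rewrite rights_app, rights_emap. simpl. rewrite Hr. simpl.
      eapply ex_unf1; reflexivity. }
  inversion R; subst; try (apply HD; left; now constructor);
    try (apply HD; right; now constructor).
  - destruct (ax_join _ _ H _ H0 H1) as (d & Ys & HY & HX).
    exists (d + k), (gupn d G), (map (fun X => (X, TH X)) Ys ++ map (eSn d) E).
    split; [|split; [|split]].
    + apply wf_add_same; auto. now apply wf_shiftn.
    + unfold eSn. now rewrite tns_app, tns_same, tns_emap.
    + unfold eSn. rewrite map_app, fst_same, fst_emap. apply HX.
    + unfold eSn. rewrite rights_app, rights_same, rights_emap. apply HX.
  - eapply INST; eauto; simpl; auto.
    + left. exists 0, (ren (up S) R0). auto.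
    + now apply bpl_shift.
  - eapply INST; eauto; simpl; auto.
    + right. exists 0, (ren (up S) T). auto.
    + now apply bpl_shift.
Qed.

Lemma expands_cons_perm k L L' C : Permutation L L' -> expands (k, L') C -> expands (k, L) C.
Proof. intros H HE. eapply expands_trans; [apply ex_perm|]; eauto. Qed.

Lemma tns_inv E n : tns E = S n -> exists X X' E', Permutation E ((X, TN X') :: E').
Proof.
  induction E as [|[X t] E IH]; simpl; [discriminate|]. intros H.
  destruct t as [| | | |X']; [..|exists X, X', E; reflexivity];
    (destruct IH as (Y & Y' & E' & HP); [exact H|];
     eexists Y, Y', (_ :: E'); rewrite HP; apply perm_swap).
Qed.

Lemma tms_inv E n : tms E = S n -> exists X X' E', Permutation E ((X, TM X') :: E').
Proof.
  induction E as [|[X t] E IH]; simpl; [discriminate|]. intros H.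
  destruct t as [| | |X'|]; [| | |exists X, X', E; reflexivity|];
    (destruct IH as (Y & Y' & E' & HP); [exact H|];
     eexists Y, Y', (_ :: E'); rewrite HP; apply perm_swap).
Qed.

Lemma sync k G E : wf k G E -> exists k2 G2 E2, wf k2 G2 E2 /\ tns E2 = 0 /\
  expands (k, map fst E) (k2, map fst E2) /\ expands (k, rights E) (k2, rights E2).
Proof.
  remember (tns E) as n eqn:Hn. revert k G E Hn.
  induction n as [|n IH]; intros k G E Hn W.
  - exists k, G, E. auto using expands_refl.
  - destruct (tns_inv E n) as (X & X' & E' & HP); auto.
    pose proof (tns_perm _ _ HP) as HT. unfold tns in HT at 2; simpl in HT.
    apply (wf_perm _ _ _ _ HP) in W.
    destruct (sync_one _ _ _ _ _ W) as (k1 & G1 & E1 & W1 & HT1 & H1 & H2).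
    unfold tns in HT1, Hn, HT. 
    destruct (IH k1 G1 E1) as (k2 & G2 & E2 & W2 & HT2 & H3 & H4); auto.
    { unfold tns. lia. }
    exists k2, G2, E2. split; [|split; [|split]]; auto.
    + eapply expands_cons_perm; [apply (Permutation_map fst HP)|].
      eapply expands_trans; eauto.
    + eapply expands_cons_perm; [apply (rights_perm _ _ HP)|].
      eapply expands_trans; eauto.
Qed.

(** * Performing the postponed communications *)

Lemma re_comm k L L2 a p P Q M :
  Permutation L (Out (Name a) p P :: In (Name a) Q :: M) ->
  Permutation L2 (P :: psub (scons p Name) Q :: M) -> reach (k, L) (k, L2).
Proof.
  intros HP H2. eapply reach_trans.
  - exact (reach_bstep _ _ _ (bs_comm k _ _ _ _ _ _ HP)).
  - apply reach_expands, ex_perm. now symmetry.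
Qed.

(** What the communication leaves contains no private channel and is paired with itself, so one [TM]
    entry goes and none comes. *)
Lemma expose_one k G X X' E : wf k G ((X, TM X') :: E) -> exists k2 G2 E2,
  wf k2 G2 E2 /\ tns E2 = tns E /\ tms E2 = tms E /\
  reach (k, X :: map fst E) (k2, map fst E2) /\
  expands (k, X' :: rights E) (k2, rights E2).
Proof.
  intros W. assert (R : leaf G X X').
  { destruct W as (_ & W & _). now inversion W. }
  apply wf_tail in W; [|discriminate].
  inversion R as [c p R0 Hc Hp HR|c T Q Hc HT HQ]; subst;
    destruct (proj1 W c _ Hc) as (_ & _ & HS); specialize (HS _ eq_refl);
    apply in_split in HS; destruct HS as (E1 & E2 & EE).
  all: pose proof (Permutation_middle E1 E2) as HP.
  - specialize (HP (Bang (In (Name c) R0), TL)). rewrite <- EE in HP.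
    apply (Permutation_map fst) in HP. simpl in HP.
    exists k, G, (map (fun X => (X, TH X)) [psub (scons p Name) R0] ++ E).
    split; [|split; [|split; [|split]]].
    + apply wf_add_same; auto. constructor; auto. now apply bpl_inst.
    + now rewrite tns_app, tns_same.
    + now rewrite tms_app, tms_same.
    + rewrite map_app, fst_same. set (X := psub _ _).
      set (F := map fst (E1 ++ E2)) in *.
      apply reach_trans with
        (k, In (Name c) R0 :: Bang (In (Name c) R0) :: Out (Name c) p Nil :: F).
      * apply reach_expands.
        eapply (ex_unf0 _ _ (Bang (In (Name c) R0)) (Out (Name c) p Nil :: F));
          [|reflexivity|].
        -- rewrite <- HP. apply perm_swap.
        -- perm_solve.
      * apply reach_trans with (k, Nil :: X :: Bang (In (Name c) R0) :: F).
        -- apply (re_comm _ _ _ c p Nil R0 (Bang (In (Name c) R0) :: F)); [perm_solve | reflexivity].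
        -- apply reach_expands. eapply ex_unf0; [reflexivity..|]. simpl.
           now apply perm_skip.
    + rewrite rights_app, rights_same. apply expands_refl.
  - specialize (HP (server c T, TL)). rewrite <- EE in HP.
    apply (Permutation_map fst) in HP. simpl in HP.
    exists (S k), (gup None G), (map (fun X => (X, TH X)) [T; Q] ++ map eS E).
    split; [|split; [|split; [|split]]].
    + apply wf_add_same.
      * apply (wf_shift_None _ _ [] E W); auto.
      * constructor; [now apply pl_gup|]. constructor; [now apply pl_gup|constructor].
    + now rewrite tns_app, tns_same, tns_emap.
    + now rewrite tms_app, tms_same, tms_emap.
    + rewrite map_app, fst_same, fst_emap.
      set (F := map fst (E1 ++ E2)) in *.
      apply reach_trans with
        (k, Nu (Out (Name (S c)) (Name 0) T) :: server c T :: In (Name c) Q :: F).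
      * apply reach_expands.
        eapply (ex_unf0 _ _ (server c T) (In (Name c) Q :: F)); [|reflexivity|].
        -- rewrite <- HP. apply perm_swap.
        -- reflexivity.
      * apply reach_trans with (S k, Out (Name (S c)) (Name 0) T ::
          ren S (server c T) :: ren S (In (Name c) Q) :: map (ren S) F).
        -- apply reach_expands. eapply ex_unf1; reflexivity.
        -- rewrite ren_In. eapply re_comm; [apply perm_skip, perm_swap|].
           (* The name received is the restriction just created, at index 0, where the right process
              also has the parameter of [Q]. *)
           replace (psub (scons (Name 0) Name) (ren (up S) Q)) with Q
             by (symmetry; psub_solve).
           simpl. do 2 apply perm_skip. symmetry in HP.
           apply (Permutation_map (ren S)) in HP. exact HP.
    + rewrite rights_app, rights_same, rights_emap.
      apply expands_trans with (S k, Par T Q :: map (ren S) (rights E)).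
      * eapply ex_unf1; reflexivity.
      * eapply ex_unf0; reflexivity.
Qed.

Lemma expose k G E : wf k G E -> tns E = 0 -> exists k2 G2 E2,
  wf k2 G2 E2 /\ tns E2 = 0 /\ tms E2 = 0 /\
  reach (k, map fst E) (k2, map fst E2) /\ expands (k, rights E) (k2, rights E2).
Proof.
  remember (tms E) as n eqn:Hn. revert k G E Hn.
  induction n as [|n IH]; intros k G E Hn W H0.
  - exists k, G, E. auto using expands_refl, reach_refl.
  - destruct (tms_inv E n) as (X & X' & E' & HP); auto.
    pose proof (tms_perm _ _ HP) as HT. unfold tms in HT at 2; simpl in HT.
    pose proof (tns_perm _ _ HP) as HT'. unfold tns in HT' at 2; simpl in HT'.
    apply (wf_perm _ _ _ _ HP) in W.
    destruct (expose_one _ _ _ _ _ W) as (k1 & G1 & E1 & W1 & HN1 & HT1 & H1 & H2).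
    unfold tms in HT1, Hn, HT. unfold tns in *.
    destruct (IH k1 G1 E1) as (k2 & G2 & E2 & W2 & HN2 & HT2 & H3 & H4); auto.
    { unfold tms. lia. }
    { lia. }
    exists k2, G2, E2. split; [|split; [|split; [|split]]]; auto.
    + eapply reach_trans; [apply reach_expands, ex_perm, (Permutation_map fst HP)|].
      eapply reach_trans; eauto.
    + eapply expands_cons_perm; [apply (rights_perm _ _ HP)|].
      eapply expands_trans; eauto.
Qed.

Lemma fst_inv (E : list entry) X M : Permutation (map fst E) (X :: M) ->
  exists t E0, Permutation E ((X, t) :: E0) /\ Permutation M (map fst E0).
Proof.
  intros H. symmetry in H. apply Permutation_map_inv in H.
  destruct H as (E1 & H1 & H2). destruct E1 as [|[Y t] E0]; [discriminate|].
  injection H1 as -> ->. exists t, E0. auto.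
Qed.

Lemma rights_inv E X M : tns E = 0 -> tms E = 0 -> Permutation (rights E) (X :: M) ->
  exists Y E0, Permutation E ((Y, TH X) :: E0) /\ Permutation M (rights E0).
Proof.
  intros H1 H2 HP.
  assert (I : List.In X (rights E)) by (rewrite HP; now left).
  apply in_flat_map in I. destruct I as ([Y t] & I & HX).
  assert (N : forall e, List.In e E -> tn1 e = 0 /\ tm1 e = 0).
  { clear - H1 H2. induction E as [|e E IH]; intros e' []; simpl in *.
    - subst. unfold tns, tms in *; simpl in *. lia.
    - apply IH; auto; unfold tns, tms in *; simpl in *; lia. }
  specialize (N _ I). apply in_split in I. destruct I as (E1 & E2 & ->).
  exists Y, (E1 ++ E2).
  assert (t = TH X) as ->.
  { unfold right1, tn1, tm1 in *; simpl in *. destruct t; simpl in *; destruct HX;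
      try tauto; subst; destruct N; congruence. }
  assert (HE : Permutation (E1 ++ (Y, TH X) :: E2) ((Y, TH X) :: E1 ++ E2))
    by (symmetry; apply Permutation_middle).
  split; auto. apply rights_perm in HE. rewrite HP in HE. simpl in HE.
  now apply Permutation_cons_inv in HE.
Qed.

(** A used copy may disappear: [env_ok] asks only for the replicated servers. *)
Lemma wf_drop k G X E : wf k G ((X, TL) :: E) -> (forall c K, srv c K <> Some X) ->
  wf k G E.
Proof.
  intros (H1 & H2 & H3) HX. split; [|split].
  - intros c K HK. destruct (H1 c K HK) as (? & ? & HS). repeat split; auto.
    intros Y HY. destruct (HS Y HY) as [[= ->]|]; auto. now apply HX in HY.
  - now inversion H2.
  - exact H3.
Qed.

Lemma tn_entries G Ys Ys' : Forall2 (rel true G) Ys Ys' -> exists es,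
  map fst es = Ys /\ rights es = Ys' /\ wns es = [] /\ Forall (eok G) es.
Proof.
  induction 1 as [|Y Y' Ys Ys' H _ (es & H1 & H2 & H3 & H4)].
  - exists []; auto.
  - exists ((Y, TN Y') :: es). simpl. rewrite H1, H2, H3. auto.
Qed.

Lemma unf_match k G E X X' E0 d Ys Ys' :
  wf k G ((X, TH X') :: E0) -> Permutation E ((X, TH X') :: E0) ->
  Forall2 (rel true (gupn d G)) Ys Ys' ->
  exists G2 E2, wf (d + k) G2 E2 /\
    map fst E2 = Ys ++ map (sh d) (map fst E0) /\
    rights E2 = Ys' ++ map (sh d) (rights E0).
Proof.
  intros W HP HF. apply wf_tail in W; [|discriminate].
  destruct (tn_entries _ _ _ HF) as (es & H1 & H2 & H3 & H4).
  exists (gupn d G), (es ++ map (eSn d) E0). split; [|split].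
  - apply wf_add; auto. now apply wf_shiftn.
  - unfold eSn. now rewrite map_app, fst_emap, H1.
  - unfold eSn. now rewrite rights_app, rights_emap, H2.
Qed.

(** * Matching single moves of either side *)

(** The exchange of 0 and [S j], written with adjacent transpositions because these generate
    [gr]. *)
Fixpoint mv (j n : nat) : nat :=
  match j with
  | 0 => swap01 n
  | S j => swap01 (up (mv j) (swap01 n))
  end.

Lemma mv_gr k j : j < k -> gr (S k) (S k) (mv j).
Proof.
  revert k. induction j as [|j IH]; intros k Hk.
  - destruct k as [|k]; [lia|]. apply gr_swap.
  - destruct k as [|k]; [lia|].
    apply (gr_comp _ (S (S k)) _ (fun n => up (mv j) (swap01 n)) swap01);
      [|apply gr_swap].
    apply (gr_comp _ (S (S k)) _ swap01 (up (mv j))); [apply gr_swap|].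
    apply gr_up, IH. lia.
Qed.

Lemma mv_spec j n : mv j n = if n =? 0 then S j else if n =? S j then 0 else n.
Proof.
  revert n. induction j as [|j IH]; intros n.
  - destruct n as [|[|n]]; reflexivity.
  - destruct n as [|[|n]]; simpl.
    + now rewrite IH.
    + destruct j; reflexivity.
    + rewrite IH. simpl. destruct (n =? j); reflexivity.
Qed.

(** Postponed communications need not be performed beforehand: one that the left carries out is
    already done on the right, up to unfolding the restriction of [(nu w)(T | Q)]. *)
Lemma match_left k G E b C : wf k G E -> tns E = 0 -> bstep b (k, map fst E) C ->
  exists k2 G2 E2, wf k2 G2 E2 /\ expands C (k2, map fst E2) /\
    reach (k, rights E) (k2, rights E2).
Proof.
  intros W HT B. inversion B as [? ? X M d Ys HP HU|? ? a p P Q M HP]; subst.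
  - destruct (fst_inv _ _ _ HP) as (t & E0 & HE & HM).
    pose proof (rights_perm _ _ HE) as HR.
    rewrite (tns_perm _ _ HE) in HT.
    apply (wf_perm _ _ _ _ HE) in W.
    assert (Ht : eok G (X, t)) by (destruct W as (_ & F & _); now inversion F).
    assert (HC : forall D : cfg, expands (d + k, Ys ++ map (sh d) (map fst E0)) D ->
      expands (d + k, Ys ++ map (sh d) M) D).
    { intros D. apply expands_cons_perm. apply Permutation_app_head.
      now apply Permutation_map. }
    assert (HD : forall D, reach (k, rights ((X, t) :: E0)) D -> reach (k, rights E) D).
    { intros D. apply reach_trans. now apply reach_expands, ex_perm. }
    destruct t as [|w|X'|X'|X']; unfold eok in Ht; simpl in Ht.
    + destruct Ht as [(c & R & Hc & [-> | ->])|(c & T & Hc & [-> | ->])];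
        simpl in HU; try discriminate; injection HU as <- <-.
      * exists k, G, ((In (Name c) R, TL) :: (Bang (In (Name c) R), TL) :: E0).
        split; [|split].
        -- apply wf_cons; auto. left; eauto 6.
        -- apply HC. rewrite map_sh0. apply expands_refl.
        -- apply HD, reach_refl.
      * exists k, G, ((Nu (Out (Name (S c)) (Name 0) T), TL) :: (server c T, TL) :: E0).
        split; [|split].
        -- apply wf_cons; auto. right; eauto 6.
        -- apply HC. rewrite map_sh0. apply expands_refl.
        -- apply HD, reach_refl.
      * apply wf_drop in W; [|now intros ? []].
        exists (S k), (gup (Some KRes) G),
          ([(Out (Name (S c)) (Name 0) T, TW 0)] ++ map eS E0).
        split; [|split].
        -- apply wf_shift; auto.
           ++ intros K [= <-]. split; [exact I|]. discriminate.
           ++ constructor; [|constructor]. split; [reflexivity|].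
              exists (S c), (psub (dup (fun i => Name (S i))) T).
              simpl. rewrite Hc. split; [reflexivity|]. f_equal. symmetry; psub_solve.
           ++ simpl. destruct W as (_ & _ & W). constructor.
              ** rewrite in_map_iff. now intros (? & ? & _).
              ** apply FinFun.Injective_map_NoDup; auto. intros x y; congruence.
        -- apply HC. rewrite map_app, fst_emap. apply expands_refl.
        -- apply HD. rewrite rights_app, rights_emap. simpl.
           apply reach_expands, expands_ceq, ceq_gc.
    + destruct Ht as (_ & c & T & _ & ->). discriminate.
    + pose proof (hd_unf _ _ _ Ht) as HH. rewrite HU in HH.
      destruct (unf X') as [[d' Ys']|] eqn:HU'; [|tauto]. destruct HH as [<- HF].
      destruct (unf_match _ _ _ _ _ _ _ _ _ W HE HF) as (G2 & E2 & W2 & H1 & H2).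
      exists (d + k), G2, E2. split; [|split]; auto.
      * apply HC. rewrite H1. apply expands_refl.
      * apply HD. rewrite H2. eapply reach_bstep, bs_unf; [|exact HU']. reflexivity.
    + inversion Ht; subst; discriminate.
    + discriminate.
  - destruct (fst_inv _ _ _ HP) as (t1 & E1 & HE & HM).
    symmetry in HM. destruct (fst_inv _ _ _ HM) as (t2 & E0 & HE2 & HM2).
    assert (HE' : Permutation E
      ((Out (Name a) p P, t1) :: (In (Name a) Q, t2) :: E0)) by now rewrite HE, HE2.
    clear HE HE2 HM HP. pose proof (rights_perm _ _ HE') as HR.
    rewrite (tns_perm _ _ HE') in HT. apply (wf_perm _ _ _ _ HE') in W.
    assert (Ht : eok G (Out (Name a) p P, t1) /\ eok G (In (Name a) Q, t2)).
    { destruct W as (_ & F & _). inversion F; subst. split; auto. now inversion H2. }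
    destruct Ht as [Ht1 Ht2].
    assert (HC : forall D : cfg, expands
       (k, P :: psub (scons p Name) Q :: map fst E0) D ->
      expands (k, P :: psub (scons p Name) Q :: M) D).
    { intros D. apply expands_cons_perm. now do 2 apply perm_skip. }
    assert (HD : forall D, reach
      (k, rights ((Out (Name a) p P, t1) :: (In (Name a) Q, t2) :: E0)) D ->
      reach (k, rights E) D).
    { intros D. apply reach_trans. now apply reach_expands, ex_perm. }
    (* The status of [a] in [G] decides which threads can meet on it; incompatible pairs are refuted
       below by comparing two values of [G a]. *)
    assert (A2 : t2 = TL /\ (exists R, G a = Some (KIn R) /\ Q = R) \/
      (exists X', t2 = TH X' /\ hd G (In (Name a) Q) X' /\ G a = None) \/
      (exists T, t2 = TM (Nu (Par T Q)) /\ G a = Some (KOut T) /\ bpl G T /\ bpl G Q)).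
    { destruct t2 as [|w|X'|X'|X']; unfold eok in Ht2; simpl in Ht2.
      - left; split; auto.
        destruct Ht2 as [(c & R & Hc & [HX | HX])|(c & T & Hc & [HX | HX])];
          try discriminate. injection HX as -> ->. eauto.
      - destruct Ht2 as (_ & c & T & _ & HX). discriminate.
      - right; left. exists X'. repeat split; auto. inversion Ht2; subst; auto.
      - right; right. inversion Ht2; subst; eauto 6.
      - unfold tns in HT; simpl in HT. lia. }
    destruct t1 as [|w|X1'|X1'|X1']; unfold eok in Ht1; simpl in Ht1.
    + destruct Ht1 as [(c & R & Hc & [HX | HX])|(c & T & Hc & [HX | HX])]; discriminate.
    + destruct Ht1 as (Hw & c & T & Hc & HX). injection HX as -> -> ->.
      destruct A2 as [(-> & R & Hc2 & _)|[(X' & _ & _ & Hc2)|(T' & -> & Hc2 & HT' & HQ)]];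
        rewrite Hc in Hc2; try discriminate. injection Hc2 as <-.
      destruct (proj1 W w _ Hw) as (Hwk & _).
      assert (HN : ~ List.In w (wns E0)).
      { destruct W as (_ & _ & W). simpl in W. now inversion W. }
      apply wf_tail in W; [|discriminate]. apply wf_tail in W; [|discriminate].
      set (f := fun n => mv w (S n)).
      assert (Hf : forall n, n <> w -> f n = S n).
      { intros n Hn. unfold f. rewrite mv_spec. simpl.
        destruct (Nat.eqb_spec n w); congruence. }
      assert (Hf0 : f w = 0) by (unfold f; rewrite mv_spec; simpl; now rewrite Nat.eqb_refl).
      assert (Hi : forall X, bpl G X ->
        ren f (psub (scons (Name w) Name) X) = X).
      { intros X HX. unfold ren. rewrite psub_inst, psub_comp.
        transitivity (psub Name X); [|now apply psub_id].
        eapply pl_ext_sub; [exact HX|]. intros [|n] Hn; simpl; [now rewrite Hf0|].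
        simpl in Hn. unfold nn in Hn. rewrite Hf; auto. intros ->. congruence. }
      exists (S k), (gup None G), (map (fun X => (X, TH X)) [T; Q] ++
        map (emap (fun n => Name (f n)) (fun n => Name (S n))) E0).
      split; [|split].
      * apply wf_add_same.
        -- apply (wf_up _ _ None k G [] E0 W); try discriminate; auto.
           ++ apply sub_ok_move.
              ** intros c' K HK. now destruct (proj1 W c' _ HK) as (_ & ? & _).
              ** intros n Hn. rewrite Hf; congruence.
           ++ intros c' _ Hc'. rewrite Hf; congruence.
           ++ intros w' Hw'. rewrite Hf; congruence.
           ++ simpl. apply FinFun.Injective_map_NoDup; [|apply W]. intros x y; congruence.
        -- constructor; [now apply pl_gup|]. constructor; [now apply pl_gup|constructor].
      * apply HC. rewrite map_app, fst_same, fst_emap. apply expands_ceq.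
        apply (ceq_ren _ _ f).
        -- apply (gr_comp k (S k) (S k) S (mv w)); [apply gr_S | now apply mv_gr].
        -- simpl. rewrite !Hi by auto. reflexivity.
      * apply HD. rewrite rights_app, rights_same, rights_emap. simpl.
        apply reach_expands.
        apply expands_trans with (S k, Par T Q :: map (ren S) (rights E0)).
        -- eapply ex_unf1; reflexivity.
        -- eapply ex_unf0; reflexivity.
    + inversion Ht1 as [| | | | |? ? ? P' Ha Hp HPP|]; subst.
      assert (Ha' : G a = None) by exact Ha.
      destruct A2 as [(-> & R & Hc2 & _)|[(X' & -> & HH & Hc2)|(T' & -> & Hc2 & _)]];
        try congruence.
      inversion HH as [| | | |? ? Q' _ HQ| |]; subst.
      apply wf_tail in W; [|discriminate]. apply wf_tail in W; [|discriminate].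
      exists k, G, ((P, TN P') :: (psub (scons p Name) Q, TN (psub (scons p Name) Q')) :: E0).
      split; [|split].
      * apply wf_cons; auto. apply wf_cons; auto. now apply rel_inst.
      * apply HC, expands_refl.
      * apply HD. simpl. eapply re_comm; reflexivity.
    + inversion Ht1 as [c q R Hc Hp HRR|]; subst.
      destruct A2 as [(-> & R' & Hc2 & ->)|[(X' & -> & HH & Hc2)|(T' & -> & Hc2 & _)]];
        try congruence.
      rewrite Hc in Hc2; injection Hc2 as <-.
      apply wf_tail in W; [|discriminate]. apply wf_drop in W; [|now intros ? []].
      exists k, G, (map (fun X => (X, TH X)) [psub (scons p Name) R] ++ E0).
      split; [|split].
      * apply wf_add_same; auto. constructor; auto. now apply bpl_inst.
      * apply HC. rewrite map_app, fst_same. eapply ex_unf0; reflexivity.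
      * apply HD. rewrite rights_app, rights_same. apply reach_refl.
    + discriminate.
Qed.

(** Without [TM] and [TN] entries every right thread is the partner in an [hd] pair, so the move is
    copied literally. *)
Lemma match_right k G E b C : wf k G E -> tns E = 0 -> tms E = 0 ->
  bstep b (k, rights E) C ->
  exists k2 G2 E2, wf k2 G2 E2 /\ expands C (k2, rights E2) /\
    reach (k, map fst E) (k2, map fst E2).
Proof.
  intros W HT HT2 B. inversion B as [? ? X M d Ys HP HU|? ? a p P Q M HP]; subst.
  - destruct (rights_inv _ _ _ HT HT2 HP) as (Y & E0 & HE & HM).
    pose proof (Permutation_map fst HE) as HR.
    apply (wf_perm _ _ _ _ HE) in W.
    assert (Ht : hd G Y X) by (destruct W as (_ & F & _); now inversion F).
    pose proof (hd_unf _ _ _ Ht) as HH. rewrite HU in HH.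
    destruct (unf Y) as [[d' Ys']|] eqn:HU'; [|tauto]. destruct HH as [-> HF].
    destruct (unf_match _ _ _ _ _ _ _ _ _ W HE HF) as (G2 & E2 & W2 & H1 & H2).
    exists (d + k), G2, E2. split; [|split]; auto.
    + apply ex_perm. rewrite H2. apply Permutation_app_head. now apply Permutation_map.
    + rewrite H1. eapply reach_bstep, bs_unf; [exact HR|exact HU'].
  - destruct (rights_inv _ _ _ HT HT2 HP) as (Y & E1 & HE & HM).
    symmetry in HM.
    pose proof (tns_perm _ _ HE) as HTE. rewrite HT in HTE.
    pose proof (tms_perm _ _ HE) as HTE2. rewrite HT2 in HTE2.
    destruct (rights_inv E1 _ _ (eq_sym HTE) (eq_sym HTE2) HM) as (Z & E0 & HE2 & HM2).
    rewrite HE2 in HE. pose proof (Permutation_map fst HE) as HR.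
    apply (wf_perm _ _ _ _ HE) in W.
    assert (Ht : hd G Y (Out (Name a) p P) /\ hd G Z (In (Name a) Q)).
    { destruct W as (_ & F & _). inversion F; subst. split; auto. now inversion H2. }
    destruct Ht as [Ht1 Ht2].
    inversion Ht1 as [| | | | |? ? P' ? Ha Hp HPP|]; subst.
    inversion Ht2 as [| | | |? Q' ? _ HQ| |]; subst.
    apply wf_tail in W; [|discriminate]. apply wf_tail in W; [|discriminate].
    exists k, G, ((P', TN P) :: (psub (scons p Name) Q', TN (psub (scons p Name) Q)) :: E0).
    split; [|split].
    + apply wf_cons; auto. apply wf_cons; auto. now apply rel_inst.
    + apply ex_perm. simpl. now do 2 apply perm_skip.
    + eapply re_comm; [exact HR|]. reflexivity.
Qed.
Lemma entry_in k G E X t : wf k G E -> List.In (X, t) E -> eok G (X, t).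
Proof. intros (_ & H & _) I. rewrite Forall_forall in H. exact (H _ I). Qed.

(** Visible names are [k + n] whereas private ones lie below [k], so neither servers nor postponed
    prefixes show a barb. *)
Lemma barb_left k G E o n : wf k G E -> tns E = 0 ->
  cbarb o (k, map fst E) n -> cbarb o (k, rights E) n.
Proof.
  intros W HT (X & HX & HB). simpl in HX, HB. apply in_map_iff in HX.
  destruct HX as ([Y t] & <- & HE). simpl in HB.
  pose proof (entry_in _ _ _ _ _ W HE) as Ht.
  assert (NS : G (k + n) = None).
  { destruct (G (k + n)) as [K|] eqn:EK; auto. destruct (proj1 W _ _ EK). lia. }
  assert (R : forall X', t = TH X' -> is_barb o (k + n) X' -> cbarb o (k, rights E) n).
  { intros X' -> B. exists X'. split; auto. apply in_flat_map. exists (Y, TH X').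
    simpl; auto. }
  destruct t as [|w|X'|X'|X']; unfold eok in Ht; simpl in Ht.
  - destruct Ht as [(c & R' & Hc & [-> | ->])|(c & T & Hc & [-> | ->])];
      (destruct o; simpl in HB; [destruct HB as (p & P & HB) | destruct HB as (P & HB)]);
      try discriminate; injection HB; congruence.
  - destruct Ht as (_ & c & T & Hc & ->).
    destruct o; simpl in HB; [destruct HB as (p & P & HB) | destruct HB as (P & HB)];
      try discriminate; injection HB; congruence.
  - apply (R X'); auto. destruct o; simpl in HB.
    + destruct HB as (p & P & ->). inversion Ht; subst. simpl; eauto.
    + destruct HB as (P & ->). inversion Ht; subst. simpl; eauto.
  - exfalso. destruct o; simpl in HB.
    + destruct HB as (p & P & ->). inversion Ht; subst; congruence.
    + destruct HB as (P & ->). inversion Ht; subst; congruence.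
  - exfalso. clear - HT HE. apply in_split in HE. destruct HE as (E1 & E2 & ->).
    rewrite tns_app in HT. unfold tns in HT; simpl in HT. lia.
Qed.

Lemma barb_right k G E o n : wf k G E -> tns E = 0 -> tms E = 0 ->
  cbarb o (k, rights E) n -> cbarb o (k, map fst E) n.
Proof.
  intros W HT HT2 (X & HX & HB). simpl in HX, HB.
  apply in_split in HX. destruct HX as (L1 & L2 & EL).
  destruct (rights_inv E X (L1 ++ L2) HT HT2) as (Y & E0 & HE & _).
  { rewrite EL. symmetry. apply Permutation_middle. }
  exists Y. split.
  - simpl. rewrite (Permutation_map fst HE). now left.
  - assert (Ht : hd G Y X).
    { apply (entry_in k G E Y (TH X) W). rewrite HE. now left. }
    simpl. destruct o; simpl in HB.
    + destruct HB as (p & P & ->). inversion Ht; subst. simpl; eauto.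
    + destruct HB as (P & ->). inversion Ht; subst. simpl; eauto.
Qed.

(** Allowing unfoldings on both sides makes this a bisimulation up to unfolding, justified by
    [expands_strip]. *)
Definition elim (C D : cfg) : Prop := exists k G E, wf k G E /\ tns E = 0 /\
  expands C (k, map fst E) /\ expands D (k, rights E).

Lemma elim_sync k G E C D : wf k G E ->
  expands C (k, map fst E) -> expands D (k, rights E) -> elim C D.
Proof.
  intros W HC HD. destruct (sync _ _ _ W) as (k2 & G2 & E2 & W2 & HT & H1 & H2).
  exists k2, G2, E2. split; [|split; [|split]]; eauto using expands_trans.
Qed.

Lemma elim_wsim : wsim elim.
Proof.
  intros C D (k & G & E & W & HT & HC & HD). split; [|split].
  - intros b C' B. destruct (expands_strip _ _ HC _ _ B) as (F & [B'|<-] & HF).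
    + destruct (match_left _ _ _ _ _ W HT B') as (k2 & G2 & E2 & W2 & H1 & H2).
      exists (k2, rights E2). split.
      * eapply reach_trans; [apply reach_expands|]; eauto.
      * eapply elim_sync; eauto using expands_refl, expands_trans.
    + exists D. split; [apply reach_refl|]. exists k, G, E; auto.
  - intros C' B. exists D. split; [apply reach_refl|]. exists k, G, E.
    split; [|split; [|split]]; auto. eapply expands_trans; [|exact HC].
    now apply expands_ceq, ceq_sym.
  - intros o n HB. exists (k, rights E). split; [now apply reach_expands|].
    eapply barb_left; eauto using expands_barb.
Qed.

(** The right may act, or show a barb, with the result of a communication that the left still has to
    make; hence [expose] comes first. *)
Lemma elim_wsim_inv : wsim (fun D C => elim C D).
Proof.
  intros D C (k & G & E & W & HT & HC & HD).
  destruct (expose _ _ _ W HT) as (k1 & G1 & E1 & W1 & HT1 & HT2 & H1 & H2).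
  assert (HD1 : expands D (k1, rights E1)) by eauto using expands_trans.
  assert (HC1 : reach C (k1, map fst E1)) by eauto using reach_trans, reach_expands.
  split; [|split].
  - intros b D' B. destruct (expands_strip _ _ HD1 _ _ B) as (F & [B'|<-] & HF).
    + destruct (match_right _ _ _ _ _ W1 HT1 HT2 B') as (k2 & G2 & E2 & W2 & H3 & H4).
      exists (k2, map fst E2). split.
      * eapply reach_trans; eauto.
      * eapply elim_sync; eauto using expands_refl, expands_trans.
    (* Here the move is an unfolding that [expands D] already contains. *)
    + exists (k1, map fst E1). split; auto.
      exists k1, G1, E1. split; [|split; [|split]]; auto using expands_refl.
  - intros D' B. exists C. split; [apply reach_refl|]. exists k, G, E.
    split; [|split; [|split]]; auto. eapply expands_trans; [|exact HD].
    now apply expands_ceq, ceq_sym.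
  - intros o n HB. exists (k1, map fst E1). split; auto.
    eapply barb_right; eauto using expands_barb.
Qed.

Definition none : env := fun _ => None.

Lemma rel_none_refl b P : rel b none P P.
Proof. apply rel_refl. apply pl_all. reflexivity. Qed.

(** The idle threads [L] and the counter [k] let [step_reach] go under parallel composition and
    restriction. *)
Lemma rel_cbis k L P Q : rel true none P Q -> cbis (k, P :: L) (k, Q :: L).
Proof.
  intros H. exists elim. split; [apply elim_wsim|]. split; [apply elim_wsim_inv|].
  apply (elim_sync k none ((P, TN Q) :: map (fun X => (X, TH X)) L)).
  - split; [|split].
    + intros c K; discriminate.
    + constructor; auto. apply Forall_map. apply Forall_forall. intros X _.
      apply hd_refl, pl_all. reflexivity.
    + simpl. rewrite wns_same. constructor.
  - simpl. rewrite fst_same. apply expands_refl.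
  - simpl. rewrite rights_same. apply expands_refl.
Qed.

(** * Equivalence of processes *)

Definition eqv : proc -> proc -> Prop := clos_refl_sym_trans proc (rel true none).

Lemma eqv_refl P : eqv P P. Proof. apply rst_refl. Qed.
Lemma eqv_sym P Q : eqv P Q -> eqv Q P. Proof. apply rst_sym. Qed.
Lemma eqv_trans P Q R : eqv P Q -> eqv Q R -> eqv P R. Proof. apply rst_trans. Qed.
Lemma eqv_rel P Q : rel true none P Q -> eqv P Q. Proof. apply rst_step. Qed.

Lemma eqv_map (F : proc -> proc) :
  (forall P Q, rel true none P Q -> rel true none (F P) (F Q)) ->
  forall P Q, eqv P Q -> eqv (F P) (F Q).
Proof.
  intros HF P Q H. induction H; eauto using eqv_refl, eqv_sym, eqv_trans, eqv_rel.
Qed.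

Lemma gup_none n : none n = gup None none n.
Proof. now destruct n. Qed.

Lemma rel_none_up b P Q : rel b none P Q -> rel b (gup None none) P Q.
Proof. intros; eapply rel_ext; eauto using gup_none. Qed.

Lemma pd_none p : pd (nn none) p.
Proof. apply pd_all. reflexivity. Qed.

Lemma eqv_par P P' Q Q' : eqv P P' -> eqv Q Q' -> eqv (Par P Q) (Par P' Q').
Proof.
  intros HP HQ. apply eqv_trans with (Par P' Q).
  - apply (eqv_map (fun X => Par X Q)); auto.
    intros; apply r_par; auto using rel_none_refl.
  - apply (eqv_map (fun X => Par P' X)); auto.
    intros; apply r_par; auto using rel_none_refl.
Qed.

Lemma eqv_bang P P' : eqv P P' -> eqv (Bang P) (Bang P').
Proof. apply eqv_map. intros; now apply r_bang. Qed.

Lemma eqv_nu P P' : eqv P P' -> eqv (Nu P) (Nu P').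
Proof. apply eqv_map. intros; now apply r_nu, rel_none_up. Qed.

Lemma eqv_in s P P' : eqv P P' -> eqv (In s P) (In s P').
Proof. apply eqv_map. intros; apply r_in; auto using pd_none, rel_none_up. Qed.

Lemma eqv_out s p P P' : eqv P P' -> eqv (Out s p P) (Out s p P').
Proof. apply (eqv_map (Out s p)). intros; apply r_out; auto using pd_none. Qed.

Lemma eqv_let p P P' : eqv P P' -> eqv (Let p P) (Let p P').
Proof.
  apply eqv_map. intros X Y H; apply r_let; auto using pd_none.
  apply rel_none_up in H. eapply rel_ext; [exact H|]. intros [|[|n]]; reflexivity.
Qed.

Lemma eqv_psub f P P' : eqv P P' -> eqv (psub f P) (psub f P').
Proof.
  apply eqv_map. intros X Y H. eapply rel_sub; eauto.
  intros n. simpl. split; auto. apply pd_none.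
Qed.

Lemma eqv_ax P Q : ax P Q -> eqv P Q.
Proof.
  intros H. apply eqv_rel, r_ax; auto; apply pl_all; reflexivity.
Qed.

Lemma scong_eqv P Q : scong P Q -> eqv P Q.
Proof.
  induction 1; eauto using eqv_par, eqv_bang, eqv_nu, eqv_in, eqv_out, eqv_let,
    eqv_refl, eqv_sym, eqv_trans, eqv_ax, ax.
Qed.

Lemma eqv_plug C P Q : eqv P Q -> eqv (plug C P) (plug C Q).
Proof.
  intros H. induction C; simpl; unfold ren; auto using eqv_par, eqv_bang, eqv_nu, eqv_in,
    eqv_out, eqv_let, eqv_refl, eqv_psub.
Qed.

Lemma eqv_cbis k L P Q : eqv P Q -> cbis (k, P :: L) (k, Q :: L).
Proof. induction 1; eauto using rel_cbis, cbis_refl, cbis_sym, cbis_trans. Qed.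

(** * From machine configurations back to processes *)

Definition pars (L : list proc) : proc := fold_right Par Nil L.
Definition rb (C : cfg) : proc := nus (fst C) (pars (snd C)).

Lemma pars_perm L L' : Permutation L L' -> scong (pars L) (pars L').
Proof.
  induction 1; simpl; eauto using scong.
Qed.

Lemma pars_app L L' : scong (pars (L ++ L')) (Par (pars L) (pars L')).
Proof.
  induction L; simpl.
  - eauto using scong.
  - eapply sc_trans; [apply sc_par; [apply sc_refl | exact IHL]|].
    apply sc_sym, sc_par_assoc.
Qed.

Lemma pars_ren r L : ren r (pars L) = pars (map (ren r) L).
Proof. induction L; simpl; auto. now rewrite ren_Par, IHL. Qed.

Lemma nus_succ k P : nus (S k) P = nus k (Nu P).
Proof. induction k; simpl in *; congruence. Qed.

Lemma nus_scong k P Q : scong P Q -> scong (nus k P) (nus k Q).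
Proof. intros H; induction k; [exact H | now apply sc_nu]. Qed.

Lemma nus_step k P Q : step P Q -> step (nus k P) (nus k Q).
Proof. intros H; induction k; [exact H | now apply st_nu]. Qed.

Lemma nu_gc P : scong P (Nu (ren S P)).
Proof.
  apply sc_sym.
  apply sc_trans with (Nu (Par (ren S P) Nil)); [apply sc_nu, sc_sym, sc_par_nil|].
  eapply sc_trans; [apply sc_scope|].
  eapply sc_trans; [apply sc_par; [apply sc_refl | apply sc_nu_nil]|]. apply sc_par_nil.
Qed.

(** The generators of [gr] are structural laws: exchange of restrictions and garbage collection,
    under further restrictions. *)
Lemma nus_ren k k' r : gr k k' r -> forall P, scong (nus k P) (nus k' (ren r P)).
Proof.
  induction 1; intros P.
  - rewrite ren_id by auto. apply sc_refl.
  - change (2 + k) with (S (S k)). rewrite !nus_succ. apply nus_scong, sc_nu_swap.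
  - rewrite nus_succ. apply nus_scong, nu_gc.
  - rewrite !nus_succ. rewrite <- ren_Nu. apply IHgr.
  - eapply sc_trans; [apply IHgr1|]. rewrite <- (ren_comp r s). apply IHgr2.
  - rewrite <- (ren_ext r s) by auto. apply IHgr.
Qed.

Lemma ceq_rb C D : ceq C D -> scong (rb C) (rb D).
Proof.
  induction 1 as [C D E|C|C D _ IH|C D F _ IH1 _ IH2]; eauto using scong.
  inversion E as [k k' r L L' G HP]; subst. unfold rb; simpl.
  eapply sc_trans; [apply (nus_ren _ _ _ G)|]. apply nus_scong.
  rewrite pars_ren. apply pars_perm. now symmetry.
Qed.

Lemma unf_rb X d Ys : unf X = Some (d, Ys) -> scong X (nus d (pars Ys)).
Proof.
  assert (PN : forall P, scong P (Par P Nil)) by (intros; apply sc_sym, sc_par_nil).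
  destruct X; simpl; try discriminate; [..|destruct p; [discriminate|]];
    intros H; injection H as <- <-; simpl.
  - apply sc_refl.
  - apply sc_par; [apply sc_refl | apply PN].
  - eapply sc_trans; [apply sc_bang|]. apply sc_par; [apply sc_refl | apply PN].
  - apply sc_nu, PN.
  - eapply sc_trans; [apply sc_let | apply PN].
Qed.

Lemma bstep_rb b C D : bstep b C D ->
  if b then scong (rb C) (rb D) else step (rb C) (rb D).
Proof.
  intros B; inversion B as [k L X M d Ys HP HU|k L a p P Q M HP]; subst; unfold rb; simpl.
  - eapply sc_trans; [apply nus_scong, pars_perm, HP|]. simpl.
    assert (E : scong (Par X (pars M)) (nus d (Par (pars Ys) (ren (Nat.add d) (pars M))))).
    { eapply sc_trans; [apply sc_par; [apply (unf_rb _ _ _ HU) | apply sc_refl]|].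
      apply unf_d in HU. destruct HU as [-> | ->]; simpl.
      - rewrite ren_id by auto. apply sc_refl.
      - eapply sc_trans; [apply sc_par_comm|].
        eapply sc_trans; [apply sc_sym, sc_scope|]. apply sc_nu, sc_par_comm. }
    assert (E2 : forall Z, nus k (nus d Z) = nus (d + k) Z).
    { intros Z. apply unf_d in HU. destruct HU as [-> | ->]; simpl; auto.
      symmetry. apply nus_succ. }
    eapply sc_trans; [apply nus_scong, E|]. rewrite E2. apply nus_scong.
    rewrite pars_ren. apply sc_sym, pars_app.
  - eapply st_scong; [apply nus_scong, pars_perm, HP| |apply sc_refl].
    apply nus_step. simpl.
    eapply st_scong; [apply sc_sym, sc_par_assoc| |apply sc_par_assoc].
    apply st_par, st_comm.
Qed.

Lemma reach_rb C D : reach C D -> forall Q, scong Q (rb C) ->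
  exists Q', steps Q Q' /\ scong Q' (rb D).
Proof.
  induction 1 as [C D [[[] B]|E]|C|C D F _ IH1 _ IH2]; intros Q HQ.
  - exists Q. split; [apply rt_refl|]. apply bstep_rb in B. eauto using scong.
  - exists (rb D). split; [|apply sc_refl]. apply rt_step. apply bstep_rb in B.
    eapply st_scong; eauto using scong.
  - exists Q. split; [apply rt_refl|]. apply ceq_rb in E. eauto using scong.
  - exists Q. split; auto. apply rt_refl.
  - destruct (IH1 _ HQ) as (Q1 & S1 & H1). destruct (IH2 _ H1) as (Q2 & S2 & H2).
    exists Q2. split; auto. eapply rt_trans; eauto.
Qed.

Definition load (P : proc) : cfg := (0, [P]).

Lemma load_nus k X : expands (load (nus k X)) (k, [X]).
Proof.
  assert (E : forall j, expands (j, [nus k X]) (k + j, [X])).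
  { induction k as [|k IH]; intros j.
    - apply expands_refl.
    - simpl nus. apply expands_trans with (S j, [nus k X]).
      + eapply ex_unf1; reflexivity.
      + replace (S k + j) with (k + S j) by lia. apply IH. }
  specialize (E 0). now rewrite Nat.add_0_r in E.
Qed.

(** In the case of [st_scong] the congruence is absorbed by [cbis], which contains it; this is why
    the target is met only up to [cbis]. *)
Lemma step_reach P P' : step P P' -> forall k L,
  exists C, reach (k, P :: L) C /\ cbis C (k, P' :: L).
Proof.
  induction 1 as [a p P Q|P P' _ IH|P P' Q _ IH|P P' Q Q' H1 _ IH H2]; intros k L.
  - exists (k, P :: psub (scons p Name) Q :: L). split.
    + apply reach_trans with (k, Out (Name a) p P :: In (Name a) Q :: L).
      * apply reach_expands. eapply ex_unf0; reflexivity.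
      * eapply re_comm; reflexivity.
    + apply cbis_sym, cbis_expands. eapply ex_unf0; reflexivity.
  - destruct (IH (S k) (map (ren S) L)) as (C & HR & HC). exists C. split.
    + eapply reach_trans; [|exact HR]. apply reach_expands. eapply ex_unf1; reflexivity.
    + eapply cbis_trans; [exact HC|]. apply cbis_sym, cbis_expands.
      eapply ex_unf1; reflexivity.
  - destruct (IH k (Q :: L)) as (C & HR & HC). exists C. split.
    + eapply reach_trans; [|exact HR]. apply reach_expands. eapply ex_unf0; reflexivity.
    + eapply cbis_trans; [exact HC|]. apply cbis_sym, cbis_expands.
      eapply ex_unf0; reflexivity.
  - destruct (IH k L) as (C & HR & HC).
    destruct (cbis_reach (k, P' :: L) (k, P :: L) C) as (D & HD & HCD); auto.
    { apply eqv_cbis, eqv_sym, scong_eqv, H1. }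
    exists D. split; auto. eapply cbis_trans; [apply cbis_sym, HCD|].
    eapply cbis_trans; [exact HC|]. apply eqv_cbis, scong_eqv, H2.
Qed.

Lemma steps_reach P P' : steps P P' -> exists C, reach (load P) C /\ cbis C (load P').
Proof.
  induction 1 as [P P' H|P|P P1 P2 _ (C & HC & H1) _ (D & HD & H2)].
  - now apply step_reach.
  - exists (load P). split; [apply reach_refl | apply cbis_refl].
  - destruct (cbis_reach _ _ _ (cbis_sym _ _ H1) HD) as (F & HF & H3).
    exists F. split; [eapply reach_trans; eauto|].
    eapply cbis_trans; [apply cbis_sym|]; eauto.
Qed.

Definition barb (o : bool) (P : proc) (n : nat) : Prop :=
  if o then out_barb P n else in_barb P n.

(** The congruent process that displays the barb unfolds to a state showing it, and [cbis] carries
    it over to [load P]. *)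
Lemma barb_cbarb o P n : barb o P n -> exists C, reach (load P) C /\ cbarb o C n.
Proof.
  intros H.
  assert (A : exists k X R, is_barb o (k + n) X /\ scong P (nus k (Par X R))).
  { destruct o; simpl in H.
    - destruct H as (k & p & Q & R & H).
      exists k, (Out (Name (k + n)) p Q), R. simpl. eauto.
    - destruct H as (k & Q & R & H). exists k, (In (Name (k + n)) Q), R. simpl. eauto. }
  destruct A as (k & X & R & HX & HP).
  assert (HC : cbis (load (nus k (Par X R))) (load P))
    by apply eqv_cbis, eqv_sym, scong_eqv, HP.
  assert (HR : reach (load (nus k (Par X R))) (k, [X; R])).
  { apply reach_expands. eapply expands_trans; [apply load_nus|].
    eapply ex_unf0; reflexivity. }
  destruct (cbis_reach _ _ _ HC HR) as (D & HD & HCD).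
  destruct (cbis_barb _ _ o n HCD) as (D' & HD' & HB).
  - exists X. simpl; auto.
  - exists D'. split; auto. eapply reach_trans; eauto.
Qed.

Lemma cbarb_barb o C n : cbarb o C n -> barb o (rb C) n.
Proof.
  destruct C as [k L]. intros (X & HX & HB). simpl in *.
  apply in_split in HX. destruct HX as (L1 & L2 & ->).
  assert (E : scong (rb (k, L1 ++ X :: L2)) (nus k (Par X (pars (L1 ++ L2))))).
  { apply nus_scong. change (Par X (pars (L1 ++ L2))) with (pars (X :: L1 ++ L2)).
    apply pars_perm. symmetry. apply Permutation_middle. }
  destruct o; simpl in HB.
  - destruct HB as (p & P & ->). now exists k, p, P, (pars (L1 ++ L2)).
  - destruct HB as (P & ->). now exists k, P, (pars (L1 ++ L2)).
Qed.

Lemma barb_scong o P Q n : scong P Q -> barb o Q n -> barb o P n.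
Proof.
  intros H. destruct o; simpl.
  - intros (k & p & Q' & R & E). exists k, p, Q', R. eauto using scong.
  - intros (k & Q' & R & E). exists k, Q', R. eauto using scong.
Qed.

Lemma load_reach_rb Q D : reach (load Q) D -> exists Q', steps Q Q' /\ scong Q' (rb D).
Proof. intros H. apply (reach_rb _ _ H). apply sc_sym, sc_par_nil. Qed.

Lemma rb_cbis Q D : scong Q (rb D) -> cbis (load Q) D.
Proof.
  intros H. apply cbis_trans with (load (rb D)).
  - apply eqv_cbis, scong_eqv, H.
  - clear H. destruct D as [k L]. apply cbis_trans with (k, [pars L]);
      [apply cbis_expands, load_nus|].
    apply cbis_expands. rewrite <- (app_nil_r L) at 2. generalize (@nil proc) as M.
    induction L as [|X L IH]; intros M; simpl.
    + eapply ex_unf0; reflexivity.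
    + apply expands_trans with (k, pars L :: X :: M).
      * eapply ex_unf0; [reflexivity..|]. apply perm_swap.
      * eapply expands_trans; [apply IH|]. apply ex_perm. symmetry.
        apply Permutation_middle.
Qed.

(** Answers found on the machine are read back by [rb], where unfoldings become congruences and
    communications become reductions. *)
Lemma cbis_barbed P Q : cbis (load P) (load Q) -> barbed_bisimilar P Q.
Proof.
  intros H. exists (fun P Q => cbis (load P) (load Q)). split; auto. clear P Q H.
  assert (B : forall o P Q, cbis (load P) (load Q) ->
    forall n, barb o P n -> weak (barb o) Q n).
  { intros o P Q H n HB. destruct (barb_cbarb _ _ _ HB) as (C & HC & HBC).
    destruct (cbis_reach _ _ _ H HC) as (D & HD & HCD).
    destruct (cbis_barb _ _ _ _ HCD HBC) as (D' & HD' & HB').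
    destruct (load_reach_rb Q D') as (Q' & S & E); [eapply reach_trans; eauto|].
    exists Q'. split; auto. eapply barb_scong; eauto using cbarb_barb. }
  split; [intros P Q; apply cbis_sym|].
  intros P Q H. split; [|split].
  - exact (B true P Q H).
  - exact (B false P Q H).
  - intros P' HS. destruct (steps_reach _ _ HS) as (C & HC & H1).
    destruct (cbis_reach _ _ _ H HC) as (D & HD & H2).
    destruct (load_reach_rb _ _ HD) as (Q' & S & E).
    exists Q'. split; auto.
    eapply cbis_trans; [apply cbis_sym, H1|]. eapply cbis_trans; [exact H2|].
    apply cbis_sym, rb_cbis, E.
Qed.

Lemma eqv_ctx_equiv P Q : eqv P Q -> ctx_equiv P Q.
Proof. intros H C _. apply cbis_barbed, eqv_cbis, eqv_plug, H. Qed.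
(** * The interpretation with resources in place of channels *)

Inductive vk : Type := VName (a : nat) | VRes (T : proc).

Definition vren (r : nat -> nat) (v : vk) : vk :=
  match v with VName a => VName (r a) | VRes T => VRes (ren (up r) T) end.

Definition varp (v : vk) (Q : proc) : proc :=
  match v with VName a => In (Name a) Q | VRes T => Nu (Par T Q) end.

(* The resource that outputs its parameter (index 0) on [a]. *)
Definition nm (a : nat) : proc := Out (Name (S a)) (Name 0) Nil.

(** What an application does with the pair [<v,d>] sent by its function: offer [T] as argument on
    [v] and hand the results on [d] to [e]. The shift by 3 skips the pair, [v] and [d]. *)
Definition appR (T e : proc) : proc :=
  Let (Name 0) (Par (server 1 (ren (up (Nat.add 3)) T))
    (Bang (In (Name 0) (ren (up (Nat.add 3)) e)))).

(* [interp] with a name generalized to the resource that consumes an output on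
   it, and a variable to a channel or to the body [T] of the server
   [!(nu w)x<w>.T]. *)
Fixpoint ik (vs : nat -> vk) (ns : nat -> proc) (e : proc) (M : term) : proc :=
  match M with
  | Var x => varp (vs x) (Bang (In (Name 0) (ren (up S) e)))
  | Lam M =>
      Nu (Nu (Par
        (ik (scons (VName 1) (fun x => vren (Nat.add 2) (vs x)))
          (fun g => ren (up (Nat.add 2)) (ns g)) (nm 0) M)
        (psub (scons (Pair (Name 1) (Name 0)) (fun n => Name (2 + n))) e)))
  | App M N =>
      Nu (Par
        (ik (fun x => vren S (vs x)) (fun g => ren (up S) (ns g)) (nm 0) M)
        (Bang (In (Name 0) (ren (up S)
          (appR (ik (fun x => vren S (vs x)) (fun g => ren (up S) (ns g)) (nm 0) N) e)))))
  | Mu b M => ik vs (scons e ns) (scons e ns b) M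
  end.

Lemma ik_ext M : forall vs vs' ns ns' e,
  (forall x, vs x = vs' x) -> (forall g, ns g = ns' g) -> ik vs ns e M = ik vs' ns' e M.
Proof.
  induction M; intros vs vs' ns ns' e Hv Hn; simpl.
  - now rewrite Hv.
  - do 3 f_equal. apply IHM; [intros [|x]; simpl|intros g]; congruence.
  - do 2 f_equal; [apply IHM1 | do 4 f_equal; apply IHM2]; intros; congruence.
  - assert (E : forall g, scons e ns g = scons e ns' g) by (intros [|g]; simpl; auto).
    rewrite E. now apply IHM.
Qed.

Lemma vren_comp r s v : vren s (vren r v) = vren (fun n => s (r n)) v.
Proof. destruct v; simpl; auto. f_equal. psub_solve. Qed.

Lemma ren_up_comp r s P : ren (up s) (ren (up r) P) = ren (up (fun n => s (r n))) P.
Proof. psub_solve. Qed.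

Lemma vren_ext r s v : (forall n, r n = s n) -> vren r v = vren s v.
Proof. intros H; destruct v; simpl; rewrite ?H; auto. f_equal. now apply ren_ext, up_ext. Qed.

Ltac proc_cong := repeat match goal with
  | |- Par _ _ = Par _ _ => f_equal
  | |- Bang _ = Bang _ => f_equal
  | |- Nu _ = Nu _ => f_equal
  | |- In _ _ = In _ _ => f_equal
  | |- Out _ _ _ = Out _ _ _ => f_equal
  | |- Let _ _ = Let _ _ => f_equal
  | |- @eq proc ?x ?x => reflexivity
  end.

Lemma appR_ren r T e : ren (up r) (appR T e) = appR (ren (up r) T) (ren (up r) e).
Proof.
  unfold appR, server. rewrite ren_Let, ren_Par, !ren_Bang, ren_Nu, ren_Out, ren_In.
  simpl. proc_cong; psub_solve.
Qed.

Lemma ik_ren M : forall r vs ns e, ren r (ik vs ns e M)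
  = ik (fun x => vren r (vs x)) (fun g => ren (up r) (ns g)) (ren (up r) e) M.
Proof.
  induction M; intros r vs ns e; simpl.
  - destruct (vs x); simpl; [rewrite ren_In | rewrite ren_Nu, ren_Par];
      rewrite ren_Bang, ren_In; simpl; proc_cong; psub_solve.
  - rewrite !ren_Nu, ren_Par, IHM. do 3 f_equal.
    + apply ik_ext.
      * intros [|x]; simpl; auto. rewrite !vren_comp. now apply vren_ext.
      * intros g. rewrite !ren_up_comp. apply ren_ext, up_ext. reflexivity.
    + psub_solve.
  - rewrite ren_Nu, ren_Par, ren_Bang, ren_In, IHM1, !appR_ren. do 2 f_equal.
    + apply ik_ext; intros.
      * rewrite !vren_comp. now apply vren_ext.
      * rewrite !ren_up_comp. now apply ren_ext, up_ext.
    + simpl. apply f_equal, f_equal. apply f_equal2; [|now rewrite !ren_up_comp].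
      rewrite !IHM2. apply ik_ext; intros.
      * rewrite !vren_comp. now apply vren_ext.
      * rewrite !ren_up_comp. now apply ren_ext, up_ext.
  - rewrite IHM.
    assert (E : forall g, ren (up r) (scons e ns g)
      = scons (ren (up r) e) (fun g => ren (up r) (ns g)) g) by now intros [|g].
    rewrite E. now apply ik_ext.
Qed.

(** Since renaming a term only precomposes the environments, the rules [red_rename] and [red_erase]
    become equalities of processes. *)
Lemma ik_tren M : forall rv rn vs ns e, ik vs ns e (tren rv rn M)
  = ik (fun x => vs (rv x)) (fun g => ns (rn g)) e M.
Proof.
  induction M; intros rv rn vs ns e; simpl.
  - reflexivity.
  - do 3 f_equal. rewrite IHM. apply ik_ext; auto. now intros [|x].
  - now rewrite IHM1, IHM2.
  - rewrite IHM.
    assert (E : forall g, scons e ns (up rn g) = scons e (fun g => ns (rn g)) g)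
      by now intros [|g].
    rewrite E. now apply ik_ext.
Qed.

(** A plain equality, because a forwarder to [a] is exactly an input whose body is the resource
    [nm a]. *)
Lemma interp_ik M : forall vs ns a,
  interp vs ns a M = ik (fun x => VName (vs x)) (fun g => nm (ns g)) (nm a) M.
Proof.
  induction M; intros vs ns a; simpl.
  - reflexivity.
  - rewrite IHM. do 3 f_equal. apply ik_ext; auto. now intros [|x].
  - rewrite IHM1, appR_ren. unfold in_pair, appR.
    apply f_equal, f_equal2; [apply ik_ext; reflexivity|].
    apply f_equal, f_equal, f_equal.
    rewrite IHM2, ren_Par. apply f_equal2; [|rewrite ren_Bang; reflexivity].
    unfold server. rewrite ren_Bang, ren_Nu, ren_Out. simpl. proc_cong.
    rewrite !ik_ren. apply ik_ext; intros; simpl; reflexivity.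
  - rewrite IHM, ik_ren. simpl.
    assert (E : forall g, ren (up (scons a idr)) (nm (scons 0 (fun g => S (ns g)) g))
      = scons (nm a) (fun g => nm (ns g)) g) by now intros [|g].
    rewrite E. now apply ik_ext.
Qed.

(* [m = true] replaces variables by servers, [m = false] replaces names. *)
Definition vrel (m : bool) (G : env) (v v' : vk) : Prop :=
  match v, v' with
  | VName a, VName a' => a = a' /\ G a = None
  | VName a, VRes T => m = true /\ G a = Some (KOut T) /\ bpl G T
  | VRes T, VRes T' => T = T' /\ bpl G T
  | VRes _, VName _ => False
  end.

(** Variables and names are replaced in separate passes because [r_rcv] wants a continuation that is
    free of private channels and equal on both sides, and the continuation of a variable contains
    [e]. *)
Definition nrel (m : bool) (G : env) (e e' : proc) : Prop :=
  if m then e = e' /\ bpl G e else rel false (gup None G) e e'.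

Lemma nrel_rel m G e e' : nrel m G e e' -> rel false (gup None G) e e'.
Proof. destruct m; simpl; auto. intros [<- H]. now apply rel_refl, pl_gup. Qed.

Lemma nrel_plain m G e : bpl G e -> nrel m G e e.
Proof. intros H; destruct m; simpl; auto. now apply rel_refl, pl_gup. Qed.

Lemma bpl_nm G a : G a = None -> bpl G (nm a).
Proof. intros H. unfold bpl, nm; simpl. auto. Qed.

Lemma vrel_S m G v v' : vrel m G v v' -> vrel m (gup None G) (vren S v) (vren S v').
Proof.
  destruct v, v'; simpl; try tauto.
  - intros [-> ->]; auto.
  - intros (-> & -> & H); repeat split.
    + now rewrite <- kmap_ren_S.
    + now apply bpl_shift.
  - intros [-> H]; split; auto. now apply bpl_shift.
Qed.

Lemma rel_up_S b G e e' : rel b (gup None G) e e' ->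
  rel b (gup None (gup None G)) (ren (up S) e) (ren (up S) e').
Proof.
  intros H. rewrite <- !kmap_ren_S. eapply rel_sub; eauto.
  apply sub_ok_gup, sub_ok_S.
Qed.

Lemma nrel_S m G e e' : nrel m G e e' -> nrel m (gup None G) (ren (up S) e) (ren (up S) e').
Proof.
  destruct m; simpl.
  - intros [<- H]; split; auto. now apply bpl_shift.
  - apply rel_up_S.
Qed.

Lemma vrel_add m G v v' d : vrel m G v v' ->
  vrel m (gupn d G) (vren (Nat.add d) v) (vren (Nat.add d) v').
Proof.
  intros H. induction d; simpl.
  - assert (E : forall v, vren (Nat.add 0) v = v).
    { intros [a|T]; simpl; auto. f_equal. apply ren_id. now intros [|n]. }
    now rewrite !E.
  - apply vrel_S in IHd. now rewrite !vren_comp in IHd.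
Qed.

Lemma nrel_add m G e e' d : nrel m G e e' ->
  nrel m (gupn d G) (ren (up (Nat.add d)) e) (ren (up (Nat.add d)) e').
Proof.
  intros H. induction d; simpl.
  - rewrite !(ren_id (up (Nat.add 0))) by now intros [|n]. exact H.
  - apply nrel_S in IHd. now rewrite !ren_up_comp in IHd.
Qed.

Lemma rel_appR m G T T' e e' : rel false (gup None G) T T' -> nrel m G e e' ->
  rel false (gup None G) (appR T e) (appR T' e').
Proof.
  intros HT He. apply (nrel_add _ _ _ _ 3), nrel_rel in He.
  assert (HT3 : nrel false G T T') by exact HT.
  apply (nrel_add _ _ _ _ 3) in HT3.
  apply r_let; [reflexivity|]. apply r_par; [|apply r_bang, r_in; [reflexivity|exact He]].
  apply r_bang, r_nu, r_out; try reflexivity. exact HT3.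
Qed.

Lemma ik_rel m M : forall G vs vs' ns ns' e e',
  (forall x, vrel m G (vs x) (vs' x)) -> (forall g, nrel m G (ns g) (ns' g)) ->
  nrel m G e e' -> rel false G (ik vs ns e M) (ik vs' ns' e' M).
Proof.
  induction M; intros G vs vs' ns ns' e e' Hv Hn He; simpl.
  - assert (Hb : rel false (gup None G) (Bang (In (Name 0) (ren (up S) e)))
      (Bang (In (Name 0) (ren (up S) e')))).
    { apply r_bang, r_in; [reflexivity|]. now apply rel_up_S, nrel_rel with m. }
    specialize (Hv x). destruct (vs x) as [a|T], (vs' x) as [a'|T']; simpl in *.
    + destruct Hv as [-> H]. now apply r_in.
    + destruct Hv as (-> & H & HT). destruct He as [<- He]. apply r_rcv; auto.
      split; [exact I|]. apply bpl_shift with (o := None) in He.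
      apply pl_gup in He. eapply pl_mono; [exact He|].
      intros [|[|n]]; simpl; auto. unfold nn; simpl. destruct (G n); congruence.
    + tauto.
    + destruct Hv as [<- HT]. apply r_nu, r_par; auto. now apply rel_refl, pl_gup.
  - apply r_nu, r_nu, r_par.
    + apply (IHM (gupn 2 G)).
      * intros [|x]; simpl; auto. apply (vrel_add _ _ _ _ 2 (Hv x)).
      * intros g. apply (nrel_add _ _ _ _ 2 (Hn g)).
      * apply nrel_plain, bpl_nm. reflexivity.
    + apply (nrel_add _ _ _ _ 2), nrel_rel in He.
      apply (rel_inst _ (gupn 2 G) (Pair (Name 1) (Name 0))) in He;
        [|split; reflexivity].
      assert (E : forall X, psub (scons (Pair (Name 1) (Name 0)) Name)
         (ren (up (Nat.add 2)) X)
         = psub (scons (Pair (Name 1) (Name 0)) (fun n => Name (2 + n))) X)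
        by (intros; psub_solve).
      now rewrite !E in He.
  - assert (IH : forall M, (forall (G : env) (vs vs' : nat -> vk) (ns ns' : nat -> proc)
           (e e' : proc),
         (forall x : nat, vrel m G (vs x) (vs' x)) ->
         (forall g : nat, nrel m G (ns g) (ns' g)) ->
         nrel m G e e' -> rel false G (ik vs ns e M) (ik vs' ns' e' M)) ->
       rel false (gup None G)
         (ik (fun x => vren S (vs x)) (fun g => ren (up S) (ns g)) (nm 0) M)
         (ik (fun x => vren S (vs' x)) (fun g => ren (up S) (ns' g)) (nm 0) M)).
    { intros M IH. apply IH; intros; auto using vrel_S, nrel_S.
      apply nrel_plain, bpl_nm. reflexivity. }
    apply r_nu, r_par; auto.
    apply r_bang, r_in; [reflexivity|]. apply rel_up_S. eapply rel_appR; eauto.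
  - apply IHM; auto.
    + intros [|g]; simpl; auto.
    + destruct b; simpl; auto.
Qed.

Lemma bpl_none_shift K P : bpl (gup (Some K) none) (ren (up S) P).
Proof. apply bpl_shift. apply pl_all. intros [|n]; reflexivity || exact I. Qed.

Lemma vrel_none_shift m K v : vrel m (gup (Some K) none) (vren S v) (vren S v).
Proof. destruct v; simpl; auto using bpl_none_shift. Qed.

(** Eliminates the linking channel of an application, of a forwarder and of a beta redex: each use
    of channel 0 as [nm 0] becomes [R]. *)
Lemma law_in R M vs vs1 ns ns1 e e1 :
  (forall x, vs1 x = vren S (vs x)) ->
  (forall g, ns1 g = ren (up S) (ns g) \/ ns1 g = nm 0 /\ ns g = R) ->
  e1 = ren (up S) e \/ e1 = nm 0 /\ e = R ->
  eqv (Nu (Par (ik vs1 ns1 e1 M) (Bang (In (Name 0) (ren (up S) R))))) (ik vs ns e M).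
Proof.
  intros Hv Hn He.
  apply eqv_trans with (Nu (ren S (ik vs ns e M))); [|apply scong_eqv, sc_sym, nu_gc].
  apply eqv_rel, r_inst_in.
  { apply pl_all. intros [|n]; reflexivity || exact I. }
  rewrite ik_ren. set (G := gup _ none).
  assert (N : forall x x1, x1 = ren (up S) x \/ x1 = nm 0 /\ x = R ->
    nrel false G x1 (ren (up S) x)).
  { intros x x1 [->|[-> ->]].
    - apply nrel_plain, bpl_none_shift.
    - unfold nrel, nm.
      (* Written as the weakened resource instantiated at its own parameter, the form that [r_msg]
         produces. *)
      replace (ren (up S) R) with (psub (scons (Name 0) Name)
        (psub (dup (fun i => Name (S i))) (ren (up S) R))) by psub_solve.
      apply r_msg; try reflexivity. rewrite kmap_ren_S. apply bpl_shift, bpl_none_shift. }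
  apply (ik_rel false); auto.
  intros x. rewrite Hv. apply vrel_none_shift.
Qed.

(** The law for explicit substitutions: variables standing for channel 0 become inlined copies of
    the server body. *)
Lemma law_out T M vs vs1 ns e :
  (forall x, vs1 x = vren S (vs x) \/ vs1 x = VName 0 /\ vs x = VRes T) ->
  eqv (Nu (Par (ik vs1 (fun g => ren (up S) (ns g)) (ren (up S) e) M)
        (server 0 (ren (up S) T)))) (ik vs ns e M).
Proof.
  intros Hv.
  apply eqv_trans with (Nu (ren S (ik vs ns e M))); [|apply scong_eqv, sc_sym, nu_gc].
  apply eqv_rel, r_inst_out.
  { apply pl_all. intros [|n]; reflexivity || exact I. }
  rewrite ik_ren. apply (ik_rel true).
  - intros x. destruct (Hv x) as [->|[-> ->]]; [apply vrel_none_shift|].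
    simpl. auto using bpl_none_shift.
  - intros g. apply nrel_plain, bpl_none_shift.
  - apply nrel_plain, bpl_none_shift.
Qed.

(** * Soundness of the reduction rules *)

Definition argp (vs : nat -> vk) (ns : nat -> proc) (N : term) : proc :=
  ik (fun x => vren S (vs x)) (fun g => ren (up S) (ns g)) (nm 0) N.

Lemma argp_ren r vs ns N : ren (up r) (argp vs ns N)
  = argp (fun x => vren r (vs x)) (fun g => ren (up r) (ns g)) N.
Proof.
  unfold argp. rewrite ik_ren. apply ik_ext; intros.
  - rewrite !vren_comp. now apply vren_ext.
  - rewrite !ren_up_comp. now apply ren_ext, up_ext.
Qed.

(** Application becomes a mere change of continuation, which is what lets a name stand for applying
    to [N] and going on. *)
Lemma ik_app vs ns e M N :
  eqv (ik vs ns e (App M N)) (ik vs ns (appR (argp vs ns N) e) M).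
Proof. apply law_in; auto. Qed.

Lemma eqv_ren r P Q : eqv P Q -> eqv (ren r P) (ren r Q).
Proof. apply eqv_psub. Qed.

Lemma eqv_appR T T' e : eqv T T' -> eqv (appR T e) (appR T' e).
Proof.
  intros H. apply eqv_let, eqv_par; [|apply eqv_refl].
  apply eqv_bang, eqv_nu, eqv_out, eqv_ren, H.
Qed.

(** [g = a] is allowed: in [red_mu] both are 0, read as the old [alpha] by [ns] and as the fresh
    [gamma] by [ns']. *)
Definition ssok (N : term) (g a : nat) (vs : nat -> vk) (ns ns' : nat -> proc) : Prop :=
  (forall b, b <> a -> ns' b = ns b) /\ ns a = appR (argp vs ns' N) (ns' g).

Lemma ssok_ren r N g a vs ns ns' : ssok N g a vs ns ns' ->
  ssok N g a (fun x => vren r (vs x)) (fun g => ren (up r) (ns g))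
    (fun g => ren (up r) (ns' g)).
Proof.
  intros [H1 H2]; split.
  - intros b Hb. now rewrite H1.
  - now rewrite H2, appR_ren, argp_ren.
Qed.

Lemma argp_vshift v vs ns N : argp (scons v vs) ns (vshift N) = argp vs ns N.
Proof. unfold argp, vshift. now rewrite ik_tren. Qed.

Lemma argp_nshift e vs ns N : argp vs (scons e ns) (nshift N) = argp vs ns N.
Proof. unfold argp, nshift. now rewrite ik_tren. Qed.

Lemma mu_cmd_eqv N g a b M vs ns e :
  eqv (ik vs (scons e ns)
        (if b =? a then appR (argp vs (scons e ns) N) (scons e ns g) else scons e ns b) M)
      (ik vs ns e (mu_cmd N g a b M)).
Proof.
  unfold mu_cmd. destruct (b =? a); [|apply eqv_refl]. apply eqv_sym, ik_app.
Qed.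

Lemma ik_ssub M : forall N g a vs ns ns' e, ssok N g a vs ns ns' ->
  eqv (ik vs ns e M) (ik vs ns' e (ssub N g a M)).
Proof.
  induction M; intros N g a vs ns ns' e H; simpl.
  - apply eqv_refl.
  - apply eqv_nu, eqv_nu, eqv_par; [|apply eqv_refl]. apply IHM.
    apply (ssok_ren (Nat.add 2)) in H. destruct H as [H1 H2]; split; auto.
    now rewrite argp_vshift.
  - apply (ssok_ren S) in H as H'.
    apply eqv_nu, eqv_par; auto. apply eqv_bang, eqv_in, eqv_ren, eqv_appR. auto.
  - assert (H' : ssok (nshift N) (S g) (S a) vs (scons e ns) (scons e ns')).
    { destruct H as [H1 H2]; split.
      - intros [|b0] Hb; simpl; auto.
      - simpl. now rewrite argp_nshift. }
    eapply eqv_trans; [apply IHM, H'|].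
    eapply eqv_trans; [|apply mu_cmd_eqv].
    replace (scons e ns b) with (if b =? S a
      then appR (argp vs (scons e ns') (nshift N)) (scons e ns' (S g)) else scons e ns' b).
    + apply eqv_refl.
    + destruct H' as [H1 H2]. destruct (Nat.eqb_spec b (S a)) as [->|Hb]; auto.
Qed.

(** A variable sent to a variable keeps its value, so the identity part of a substitution introduces
    no server. *)
Definition tsok (vs : nat -> vk) (ns : nat -> proc) (v : vk) (t : term) : Prop :=
  (exists y, t = Var y /\ v = vs y) \/ v = VRes (argp vs ns t).

Lemma tsok_ren r vs ns v t : tsok vs ns v t ->
  tsok (fun x => vren r (vs x)) (fun g => ren (up r) (ns g)) (vren r v) t.
Proof.
  intros [(y & -> & ->)| ->]; [left; eauto|]. right. simpl. now rewrite argp_ren.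
Qed.

Lemma ik_tsub M : forall s vs vs' ns e, (forall x, tsok vs' ns (vs x) (s x)) ->
  eqv (ik vs ns e M) (ik vs' ns e (tsub s M)).
Proof.
  induction M; intros s vs vs' ns e H; simpl.
  - destruct (H x) as [(y & Es & ->)|Es]; [rewrite Es; apply eqv_refl|].
    (* An inlined copy reads [(nu w)([[N]]_w | !w(z).e)]; this generalized forwarder is removed like
       the link of an application. *)
    rewrite Es. simpl. apply (law_in e); auto.
  - apply eqv_nu, eqv_nu, eqv_par; [|apply eqv_refl]. apply IHM.
    intros [|x]; simpl.
    + left. exists 0. auto.
    + destruct (tsok_ren (Nat.add 2) _ _ _ _ (H x)) as [(y & E1 & E2)|E].
      * left. exists (S y). rewrite E1. auto.
      * right. now rewrite argp_vshift.
  - assert (H' : forall x, tsok (fun x => vren S (vs' x)) (fun g => ren (up S) (ns g))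
      (vren S (vs x)) (s x)) by (intros; now apply tsok_ren).
    apply eqv_nu, eqv_par; auto. apply eqv_bang, eqv_in, eqv_ren, eqv_appR. auto.
  - apply IHM. intros x. destruct (H x) as [(y & E1 & E2)|E].
    + left. exists y. rewrite E1. auto.
    + right. now rewrite argp_nshift.
Qed.

Lemma ik_beta vs ns e M N : eqv (ik vs ns e (App (Lam M) N)) (ik vs ns e (subst_var M N)).
Proof.
  eapply eqv_trans; [apply ik_app|].
  set (T := argp vs ns N).
  apply eqv_trans with (ik (scons (VRes T) vs) ns e M).
  2:{ apply ik_tsub. intros [|x]; [right; reflexivity|]. left. exists x; auto. }
  (* The contractum is expanded backwards: [law_out] restores the server of the variable, then
     [law_in] the channel of the result. The redex meets this up to [sc_let] and scope. *)
  eapply eqv_trans; [|apply (law_out T) with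
    (vs1 := scons (VName 0) (fun x => vren S (vs x)))].
  2:{ intros [|x]; auto. }
  eapply eqv_trans; [|apply eqv_nu, eqv_par; [|apply eqv_refl]].
  2:{ apply (law_in (ren (up S) e)) with
        (vs1 := scons (VName 1) (fun x => vren (Nat.add 2) (vs x)))
        (ns1 := fun g => ren (up (Nat.add 2)) (ns g)) (e1 := nm 0); auto.
      - intros [|x]; simpl; auto. now rewrite vren_comp.
      - intros g. left. now rewrite ren_up_comp. }
  simpl. apply eqv_nu, scong_eqv.
  set (P := ik _ _ _ M).
  eapply sc_trans; [apply sc_nu, sc_par; [apply sc_refl | apply sc_let]|].
  (* The server of the variable does not mention the inner channel; written with [ren S], it can
     leave the inner restriction by [sc_scope]. *)
  match goal with |- scong (Nu (Par P ?X)) _ =>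
    replace X with (Par (ren S (server 0 (ren (up S) T)))
      (Bang (In (Name 0) (ren (up S) (ren (up S) e))))) end.
  - set (F := Bang _).
    apply sc_trans with (Nu (Par (ren S (server 0 (ren (up S) T))) (Par P F))).
    + apply sc_nu. eapply sc_trans; [apply sc_sym, sc_par_assoc|].
      eapply sc_trans; [apply sc_par; [apply sc_par_comm | apply sc_refl]|].
      apply sc_par_assoc.
    + eapply sc_trans; [apply sc_scope | apply sc_par_comm].
  - unfold ren, server; simpl. rewrite !psub_comp. proc_cong; psub_solve.
Qed.

(** Quantifying over [vs], [ns] and [e] lets the induction hypotheses follow the interpretation
    under every constructor. *)
Lemma red_sound M N : red M N -> forall vs ns e, eqv (ik vs ns e M) (ik vs ns e N).
Proof.
  induction 1; intros vs ns e; simpl.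
  - apply ik_beta.
  - eapply eqv_trans; [apply (ik_app _ _ _ (Mu b M) N)|]. simpl.
    set (R := appR (argp vs ns N) e).
    (* Index 0 denotes [R] before the replacement, as [alpha], and [e] after it, as [gamma]. *)
    eapply eqv_trans; [apply (ik_ssub _ (nshift N) 0 0) with (ns' := scons e ns)|].
    { split.
      - intros [|b0] Hb; [congruence | reflexivity].
      - simpl. now rewrite argp_nshift. }
    eapply eqv_trans; [|apply mu_cmd_eqv].
    rewrite argp_nshift. destruct b; apply eqv_refl.
  (* The inner bound name already denotes the resource of [b], so renaming it to [b] changes
     nothing. *)
  - rewrite ik_tren.
    assert (E : forall g, scons e ns (scons b idr g)
      = scons (scons e ns b) (scons e ns) g) by now intros [|g].
    rewrite E. erewrite ik_ext; [apply eqv_refl| |]; auto.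
  - unfold nshift. rewrite ik_tren. apply eqv_refl.
  - apply eqv_nu, eqv_nu, eqv_par; [apply IHred | apply eqv_refl].
  - apply eqv_nu, eqv_par; [apply IHred | apply eqv_refl].
  - apply eqv_nu, eqv_par; [apply eqv_refl|].
    apply eqv_bang, eqv_in, eqv_ren, eqv_appR, IHred.
  - apply IHred.
Qed.

Lemma eq_bm_eqv M N a : eq_bm M N -> eqv (sem a M) (sem a N).
Proof.
  unfold sem. rewrite !interp_ik.
  induction 1; eauto using red_sound, eqv_refl, eqv_sym, eqv_trans.
Qed.

Theorem theorem4p4 (M N : term) (a : nat) :
  eq_bm M N -> ctx_equiv (sem a M) (sem a N).
Proof. intros H. now apply eqv_ctx_equiv, eq_bm_eqv. Qed.
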